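(* Let $S$ be a regular Nörlund method with weights $\sigma_{n,k}=\tau_n\sigma_{n-k}$ and let $\mu^{(k)}$, $k\in\mathbb{N}_0$, be in the mean Nevai class $M^{(S)}(\Sigma_{l_a,l_b})$. Let $$\mathrm{d}\bar{\mu}_n=\sum_{k=0}^n\sigma_{n,k}(p_k^{(n-k)}(x))^2\,\mathrm{d}\mu^{(n-k)},\qquad \mathrm{d}\lambda_n=\frac{1}{N_n}\sum_{k=0}^n\sigma_{n,k}K_k^{(n-k)}(x,x)\,\mathrm{d}\mu^{(n-k)} .$$ Then the sequence $\lambda_n$ converges weakly to the equilibrium measure $\mu_\Sigma$, i.e. to the weak limit of the sequence $\bar{\mu}_n$ (which exists): $$\operatorname*{w-lim}_{n\to\infty}\lambda_n=\operatorname*{w-lim}_{n\to\infty}\bar{\mu}_n=\mu_\Sigma .$$ In particular, for every continuous function $f:\mathbb{R}\to\mathbb{R}$, $$\lim_{n\to\infty}\frac{1}{N_n}\sum_{k=0}^n\sigma_{n,k}\int_{\mathbb{R}}f(x)K_k^{(n-k)}(x,x)\,\mathrm{d}\mu^{(n-k)}=\int_{\mathbb{R}}f(x)\,\mathrm{d}\mu_\Sigma .$$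
   Context: Orthogonal polynomials. $\mu^{(k)}$, $k\in\mathbb{N}_0$, is a family of non-negative finite Borel measures on $\mathbb{R}$, each supported on a bounded interval and having infinite support. For each $k$, $p_l^{(k)}$, $l\in\mathbb{N}_0$, is the polynomial of degree $l$ with positive leading coefficient such that $(p_l^{(k)})_{l\ge 0}$ is orthonormal with respect to $\langle f,g\rangle^{(k)}=\int_{\mathbb{R}} f\overline{g}\,\mathrm{d}\mu^{(k)}$. With $p_{-1}^{(k)}=0$ they satisfy $x p_l^{(k)}(x)=b_{l+1}^{(k)}p_{l+1}^{(k)}(x)+a_l^{(k)}p_l^{(k)}(x)+b_l^{(k)}p_{l-1}^{(k)}(x)$ for $l\in\mathbb{N}_0$, with $a_l^{(k)}\in\mathbb{R}$ and $b_{l+1}^{(k)}>0$; by convention $b_0^{(k)}=0$. The Christoffel-Darboux kernel is $K_n^{(k)}(x,y)=\sum_{l=0}^n p_l^{(k)}(x)p_l^{(k)}(y)$. Regular Nörlund method. A summation method $S$ is an array of weights $\sigma_{n,k}$, $0\le k\le n$, $n\in\mathbb{N}_0$. It is regular if (i) $\sigma_{n,k}\ge 0$ for all $0\le k\le n$; (ii) $\sum_{k=0}^n\sigma_{n,k}=1$ for all $n$; (iii) $\lim_{n\to\infty}\sigma_{n,k}=0$ for every fixed $k\in\mathbb{N}_0$. It is a Nörlund method if $\sigma_{n,k}=\tau_n\sigma_{n-k}$ for non-negative sequences $(\sigma_n)_{n\in\mathbb{N}_0}$ and $(\tau_n)_{n\in\mathbb{N}_0}$. For a regular Nörlund method necessarily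 $\tau_n=(\sum_{k=0}^n\sigma_{n-k})^{-1}>0$, and one sets $N_n=\tau_n\sum_{k=0}^n\frac{1}{\tau_k}$. Mean Nevai class. For a regular summation method $S$, the family $\mu^{(k)}$, $k\in\mathbb{N}_0$, is in $M^{(S)}(\Sigma_{l_a,l_b})$, where $(\Sigma_{l_a,l_b})_{l_a,l_b\in\mathbb{N}_0}$ are real numbers, if (i) $\sup_{n,k\in\mathbb{N}_0}|a_n^{(k)}|<\infty$ and $\sup_{n,k\in\mathbb{N}_0}|b_n^{(k)}|<\infty$; (ii) $\lim_{n\to\infty}\sum_{k=0}^n\sigma_{n,k}|a_{k+l}^{(n-k)}-a_k^{(n-k)}|=0$ and $\lim_{n\to\infty}\sum_{k=0}^n\sigma_{n,k}|b_{k+l}^{(n-k)}-b_k^{(n-k)}|=0$ for all $l\in\mathbb{N}$; (iii) $\lim_{n\to\infty}\sum_{k=0}^n\sigma_{n,k}(a_k^{(n-k)})^{l_a}(b_k^{(n-k)})^{l_b}=\Sigma_{l_a,l_b}$ for all $l_a,l_b\in\mathbb{N}_0$ (a zeroth power equals $1$). *)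

(* Defs.v *)
From HB Require Import structures.
From mathcomp Require Import all_boot all_order all_algebra.
From mathcomp Require Import all_classical all_reals all_analysis.
From mathcomp Require Import measurable_realfun.

Set Implicit Arguments.
Unset Strict Implicit.
Unset Printing Implicit Defensive.

Import Order.TTheory GRing.Theory Num.Theory.
Import numFieldNormedType.Exports.

Local Open Scope classical_set_scope.
Local Open Scope ring_scope.

Section density.
Context d (T : measurableType d) (R : realType).
Variables (mu : {measure set T -> \bar R}) (g : T -> R).
Hypotheses (mg : measurable_fun setT g) (g0 : forall x, 0 <= g x).

(* The measure g dmu. The two unused proofs are arguments so that it can be
   given a canonical measure structure. *)
Definition mdensity of measurable_fun setT g & (forall x, 0 <= g x) :=
  fun A : set T => (\int[mu]_(x in A) (g x)%:E)%E.

Let mdensity0 : mdensity mg g0 set0 = 0%E.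
Proof. by rewrite /mdensity integral_set0. Qed.

Let mdensity_ge0 A : (0 <= mdensity mg g0 A)%E.
Proof. by apply: integral_ge0 => x _; rewrite lee_fin. Qed.

Let mdensity_sigma_additive : semi_sigma_additive (mdensity mg g0).
Proof.
apply: semi_sigma_additive_nng_induced; first exact/measurable_EFinP.
by move=> x; rewrite lee_fin.
Qed.

HB.instance Definition _ := isMeasure.Build _ _ _ (mdensity mg g0)
  mdensity0 mdensity_ge0 mdensity_sigma_additive.

End density.

Section borel_measures.
Context (R : realType).
Local Notation RR := (measurableTypeR R).
Implicit Types (mu : {measure set RR -> \bar R}).

Definition bounded_support mu :=
  exists u v : R, mu (~` `[u, v]%classic) = 0%E.

Definition msupport mu : set R :=
  [set x | forall e : R, 0 < e -> (0 < mu (ball x e))%E].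

Definition weak_cvg (nu : nat -> {measure set RR -> \bar R}) mu :=
  forall f : R -> R, continuous f -> bounded_fun f ->
    ((\int[nu n]_x (f x)%:E) @[n --> \oo] --> \int[mu]_x (f x)%:E)%E.

End borel_measures.

Section orthogonal_polynomials.
Context (R : realType).
Implicit Types (p : nat -> {poly R}) (a b : nat -> R).

Definition orthonormal_polys
    (mu : {measure set (measurableTypeR R) -> \bar R}) p :=
  [/\ forall l, size (p l) = l.+1,
      forall l, 0 < lead_coef (p l) &
      forall l m, \int[mu]_x ((p l).[x] * (p m).[x]) = (l == m)%:R].

Definition prev_poly p (l : nat) : {poly R} :=
  if l is m.+1 then p m else 0.

Definition jacobi_coefs p a b :=
  [/\ b 0 = 0,
      forall l, 0 < b l.+1 &
      forall l, 'X * p l =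
        b l.+1 *: p l.+1 + a l *: p l + b l *: prev_poly p l].

Definition CDkernel p (n : nat) (x y : R) : R :=
  \sum_(l < n.+1) (p l).[x] * (p l).[y].

Lemma measurable_sqr_poly (q : {poly R}) :
  measurable_fun setT (fun x : measurableTypeR R => q.[x] ^+ 2).
Proof.
under eq_fun do rewrite -horner_exp.
by apply: continuous_measurable_fun; exact: continuous_horner.
Qed.

Lemma sqr_poly_ge0 (q : {poly R}) (x : measurableTypeR R) : 0 <= q.[x] ^+ 2.
Proof. exact: sqr_ge0. Qed.

Lemma measurable_CDkernel p n :
  measurable_fun setT (fun x : measurableTypeR R => CDkernel p n x x).
Proof.
apply: measurable_sum => i; under eq_fun do rewrite -hornerM.
by apply: continuous_measurable_fun; exact: continuous_horner.
Qed.

Lemma CDkernel_ge0 p n (x : measurableTypeR R) : 0 <= CDkernel p n x x.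
Proof. by apply: sumr_ge0 => i _; rewrite -expr2 sqr_ge0. Qed.

End orthogonal_polynomials.

Section summation_methods.
Context (R : realType).

(* An array of weights is a total function of (n, k); only the entries with
   k <= n are meaningful. *)
Definition regular_method (w : nat -> nat -> R) :=
  [/\ forall n k, (k <= n)%N -> 0 <= w n k,
      forall n, \sum_(k < n.+1) w n k = 1 &
      forall k, w n k @[n --> \oo] --> 0].

Definition norlund_weight (s tau : nat -> {nonneg R}) (n k : nat)
  : {nonneg R} := ((tau n)%:num * (s (n - k)%N)%:num)%:nng.

Definition norlund_norm (tau : nat -> {nonneg R}) (n : nat) : R :=
  (tau n)%:num * \sum_(k < n.+1) ((tau k)%:num)^-1.

Lemma norlund_norm_inv_ge0 tau n : 0 <= (norlund_norm tau n)^-1.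
Proof.
by rewrite invr_ge0 mulr_ge0// sumr_ge0// => i _; rewrite invr_ge0.
Qed.

(* The coefficients with lower index l and upper index (k) are a k l, b k l. *)
Definition mean_nevai (w : nat -> nat -> R) (Sigma : nat -> nat -> R)
    (a b : nat -> nat -> R) :=
  [/\ has_ubound (range (fun nk : nat * nat => `|a nk.2 nk.1|)) /\
      has_ubound (range (fun nk : nat * nat => `|b nk.2 nk.1|)),
      forall l, (0 < l)%N ->
        (\sum_(k < n.+1) w n k * `|a (n - k)%N (k + l)%N - a (n - k)%N k|)
          @[n --> \oo] --> 0 /\
        (\sum_(k < n.+1) w n k * `|b (n - k)%N (k + l)%N - b (n - k)%N k|)
          @[n --> \oo] --> 0 &
      forall la lb,
        (\sum_(k < n.+1) w n k * (a (n - k)%N k ^+ la * b (n - k)%N k ^+ lb))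
          @[n --> \oo] --> Sigma la lb].

End summation_methods.

Section averaged_measures.
Context (R : realType).
Variables (s tau : nat -> {nonneg R}).
Variables (mu : nat -> {measure set (measurableTypeR R) -> \bar R}).
Variables (p : nat -> nat -> {poly R}).

Definition mu_bar (n : nat) : {measure set (measurableTypeR R) -> \bar R} :=
  msum (fun k => mscale (norlund_weight s tau n k)
    (mdensity (mu (n - k)%N) (measurable_sqr_poly (p (n - k)%N k))
       (sqr_poly_ge0 (p (n - k)%N k)))) n.+1.

Definition lambda (n : nat) : {measure set (measurableTypeR R) -> \bar R} :=
  mscale (NngNum (norlund_norm_inv_ge0 tau n))
    (msum (fun k => mscale (norlund_weight s tau n k)
      (mdensity (mu (n - k)%N) (measurable_CDkernel (p (n - k)%N) k)
         (CDkernel_ge0 (p (n - k)%N) k))) n.+1).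

End averaged_measures.

(* Main.v *)
Require Import Defs.
From HB Require Import structures.
From mathcomp Require Import all_boot all_order all_algebra.
From mathcomp Require Import all_classical all_reals all_analysis.
From mathcomp Require Import measurable_realfun zify ring lra.
Import Order.TTheory GRing.Theory Num.Theory.
Import numFieldNormedType.Exports.
Set Implicit Arguments.
Unset Strict Implicit.
Unset Printing Implicit Defensive.
Local Open Scope classical_set_scope.
Local Open Scope ring_scope.

(** The argument is the method of moments followed by a summation by
    antidiagonals.

    The entries of the m-th power of the Jacobi matrix of mu^(N) are the
    integrals of x^m p_k p_i against mu^(N) (jacobi_power), and the m-th moment
    of mu_bar_n is a Norlund average of their diagonal values (k, k).  By the
    three-term recursion each entry is a universal polynomial in the
    coefficients a_j, b_j with j within distance m of k.  Condition (ii) of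
    the mean Nevai class, which only compares k with k + l, also controls
    k - l because the weights tau_n s_{n-k} depend on n - k up to the
    factor tau_n, and tau_n decreases; so on average every a_j, b_j may be
    replaced by a_k, b_k.  What remains is an average of a polynomial in
    (a_k, b_k), which converges by condition (iii).  The replacement is an
    induction on m (stable_jacobi_power): the bounded arrays whose averages
    against all monomials in a and b converge form a class stable under
    addition, multiplication by a and by b, and bounded perturbation by arrays
    of null average.

    If M bounds all coefficients, the moments of p_0^2 dmu^(N) are at most
    (3M)^m, which confines every mu^(N) to one common segment [-L, L]
    (support_jacobi_bound).  Hence integration against mu_bar_n and lambda_n are
    positive functionals of total mass 1 that only see [-L, L].  By the
    Weierstrass theorem, convergence of moments gives convergence on every
    continuous function; the limit is again such a functional, and is
    integration against a probability measure (method_of_moments).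

    Finally lambda_n is a mean of mu_bar_0, ..., mu_bar_n.  Since
    tau_n s_{n-k} = tau_n s_N with N = n - k, regrouping the
    pairs (N, l), N + l <= n, of the double sum over k and l <= k according to
    j = N + l gives
      lambda_n = (sum_{j <= n} mu_bar_j / tau_j) / (sum_{j <= n} 1 / tau_j)
    (lambda_meanE).  The weights 1 / tau_j are at least 1 / tau_0 > 0, so these
    means have the same limit as mu_bar_n (cvg_weighted_mean). *)

(** * Polynomial approximation on a segment *)

Section weierstrass.
Variable R : realType.
Implicit Types (phi psi : nat -> R) (x c e L : R) (f : R -> R).

Lemma unif_continuous_itv f (u v : R) : continuous f ->
  forall e, 0 < e -> exists2 d, 0 < d & forall x y,
    u <= x <= v -> u <= y <= v -> `|x - y| < d -> `|f x - f y| < e.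
Proof.
move=> cf e e0.
have := @segment_compact R u v.
move=> /compact_near_coveringP /(_ _ (at_right (0:R))
  (fun d y => forall x, `|x - y| < d -> `|f x - f y| < e)) [].
  move=> x _.
  have /cvgrPdist_lt /(_ (e / 2)) := cf x.
  rewrite divr_gt0// => /(_ erefl) /nbhs_ballP [d /= d0 df].
  exists (ball x (d / 2), [set t | t < d / 2]) => /=.
    by split; [exact: nbhsx_ballx (divr_gt0 _ _)|
       exact: nbhs_right_lt (divr_gt0 _ _)].
  move=> [y t] /= [xy td] z zy.
  have fy : `|f x - f y| < e / 2.
    apply: df; apply: le_ball xy.
    by rewrite ler_pdivrMr// ler_pMr// ler1n.
  have fz : `|f x - f z| < e / 2.
    apply: df; rewrite /ball/=.
    rewrite -(subrKA y) (le_lt_trans (ler_normD _ _))// [ltRHS]splitr.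
    by rewrite ltrD// distrC (lt_trans zy).
  rewrite -(subrKA (f x)) (le_lt_trans (ler_normD _ _))// [ltRHS]splitr.
  by rewrite distrC ltrD.
move=> d /= d0 H.
exists (d / 2); first by rewrite divr_gt0.
move=> x y _ yuv xy.
have d20 : 0 < d / 2 by rewrite divr_gt0.
have dd : ball (0 : R) d (d / 2).
  by rewrite /ball/= sub0r normrN gtr0_norm// ltr_pdivrMr// ltr_pMr// ltr1n.
have := H _ dd d20 y; apply => //.
Qed.

(** The value at x is the expectation of phi (S_n), where S_n has the binomial
    law of parameters n and x.  Conditioning on the first trial gives this
    recursion, from which positivity and the variance follow by induction,
    without binomial coefficients. *)
Fixpoint bernstein phi n : {poly R} :=
  if n is m.+1 then
    (1 - 'X) * bernstein phi m + 'X * bernstein (phi \o S) m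
  else (phi 0)%:P.

Lemma bernsteinS phi n x : (bernstein phi n.+1).[x] =
  (1 - x) * (bernstein phi n).[x] + x * (bernstein (phi \o S) n).[x].
Proof. by rewrite /= !hornerE. Qed.

Lemma bernstein_le n phi psi x : 0 <= x <= 1 ->
  (forall k, (k <= n)%N -> phi k <= psi k) ->
  (bernstein phi n).[x] <= (bernstein psi n).[x].
Proof.
move=> /andP[x0 x1].
elim: n phi psi => [|n IH] phi psi le_pp; first by rewrite !hornerC le_pp.
rewrite !bernsteinS lerD// ler_wpM2l ?subr_ge0//; apply: IH => k kn.
  by rewrite le_pp// ltnW.
exact: le_pp.
Qed.

(** The bias-variance identity: n x (1 - x) is the variance of S_n and
    (n x - c)^2 the squared distance from its mean to c. *)
Lemma bernstein_quadratic n (al be c x : R) :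
  (bernstein (fun k => al + be * (k%:R - c) ^+ 2) n).[x] =
  al + be * (n%:R * (x * (1 - x)) + (n%:R * x - c) ^+ 2).
Proof.
elim: n c => [|n IH] c; first by rewrite /= hornerC; ring.
rewrite bernsteinS IH.
have -> : (fun k => al + be * (k%:R - c) ^+ 2) \o S =
    fun k => al + be * (k%:R - (c - 1)) ^+ 2.
  by apply/funext => k /=; rewrite -natr1; ring.
by rewrite IH -natr1; ring.
Qed.

(** Chebyshev's argument: |f x - f y| is at most e / 2 when y is d-close to x
    and at most 2 M otherwise, hence at most e / 2 + 2 M (x - y)^2 / d^2 for
    all y; averaging over y = S_n / n costs e / 2 + 2 M x (1 - x) / (n d^2). *)
Lemma weierstrass01 f : continuous f -> forall e, 0 < e ->
  exists q : {poly R}, forall x, 0 <= x <= 1 -> `|f x - q.[x]| <= e.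
Proof.
move=> cf e e0.
have [d d0 fd] := @unif_continuous_itv f 0 1 cf _ (divr_gt0 e0 (@ltr0n R 2)).
have [M M0 fM] : exists2 M, 0 < M & forall x, 0 <= x <= 1 -> `|f x| <= M.
  have /compact_bounded/ex_strict_bound_gt0[M M0 fM] : compact (f @` `[0, 1]).
    apply: continuous_compact; last exact: segment_compact.
    exact: continuous_subspaceT.
  exists M => // x x01; apply/ltW/fM; exists x => //=.
have [n n_gt] : exists n, 4 * M / d ^+ 2 / e < n.+1%:R.
  by exists (Num.truncn (4 * M / d ^+ 2 / e)); exact: truncnS_gt.
have n0 : 0 < n.+1%:R :> R by [].
have nn0 : n.+1%:R != 0 :> R by [].
have K0 : 0 < 2 * M / d ^+ 2 by rewrite divr_gt0// ?exprn_gt0// mulr_gt0.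
have alg1 (K N z k : R) : N != 0 ->
    K / N ^+ 2 * (k - N * z) ^+ 2 = K * (z - k / N) ^+ 2.
  by move=> N0; field.
have alg2 (K N z : R) : N != 0 -> K / N ^+ 2 * (N * z) = K / N * z.
  by move=> N0; field.
exists (bernstein (fun k => f (k%:R / n.+1%:R)) n.+1) => x x01.
have key k : (k <= n.+1)%N -> `|f x - f (k%:R / n.+1%:R)| <=
   e / 2 + 2 * M / d ^+ 2 / n.+1%:R ^+ 2 * (k%:R - n.+1%:R * x) ^+ 2.
  move=> kn; set y := k%:R / n.+1%:R.
  have y01 : 0 <= y <= 1 by rewrite divr_ge0//= ler_pdivrMr// mul1r ler_nat.
  have -> : 2 * M / d ^+ 2 / n.+1%:R ^+ 2 * (k%:R - n.+1%:R * x) ^+ 2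
      = 2 * M / d ^+ 2 * (x - y) ^+ 2.
    exact: alg1.
  have [xy|xy] := ltP `|x - y| d.
    apply/ltW/(lt_le_trans (fd _ _ x01 y01 xy)).
    by rewrite lerDl mulr_ge0 ?sqr_ge0// ltW.
  have d2 : 1 <= (x - y) ^+ 2 / d ^+ 2.
    rewrite ler_pdivlMr ?exprn_gt0// mul1r -(real_normK (num_real (x - y))).
    by rewrite ler_pXn2r ?nnegrE// ltW.
  have fxy : `|f x - f y| <= 2 * M.
    apply: le_trans (ler_normB _ _) _.
    by rewrite mulr2n mulrDl mul1r lerD// fM.
  apply: (le_trans fxy).
  have -> : 2 * M / d ^+ 2 * (x - y) ^+ 2 = 2 * M * ((x - y) ^+ 2 / d ^+ 2).
    by rewrite mulrAC -mulrA.
  rewrite -[leLHS]mulr1 -[leLHS]add0r lerD ?divr_ge0// ?(ltW e0)//.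
  by rewrite ler_pM2l// mulr_gt0.
have x1x : x * (1 - x) <= 1 by nra.
have small : e / 2 + 2 * M / d ^+ 2 / n.+1%:R ^+ 2 *
   (n.+1%:R * (x * (1 - x)) + (n.+1%:R * x - n.+1%:R * x) ^+ 2) <= e.
  rewrite subrr expr0n/= addr0.
  have -> : 2 * M / d ^+ 2 / n.+1%:R ^+ 2 * (n.+1%:R * (x * (1 - x))) =
    2 * M / d ^+ 2 / n.+1%:R * (x * (1 - x)).
    exact: alg2.
  have h : 2 * M / d ^+ 2 / n.+1%:R <= e / 2.
    rewrite ler_pdivrMr// ltW//.
    move: n_gt; rewrite ltr_pdivrMr// => n_gt.
    have -> : 2 * M / d ^+ 2 = (4 * M / d ^+ 2) / 2 by field; rewrite gt_eqF.
    by rewrite [ltRHS]mulrAC ltr_pM2r ?invr_gt0// [ltRHS]mulrC.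
  have h0 : 0 <= 2 * M / d ^+ 2 / n.+1%:R by rewrite divr_ge0// ltW.
  rewrite [leRHS]splitr lerD2l; apply: le_trans h.
  by rewrite -[leRHS]mulr1 ler_wpM2l.
rewrite distrC ler_distl; apply/andP; split.
- pose lo k : R := (f x - e / 2) + - (2 * M / d ^+ 2 / n.+1%:R ^+ 2)
                                   * (k%:R - n.+1%:R * x) ^+ 2.
  have : (bernstein lo n.+1).[x] <=
         (bernstein (fun k => f (k%:R / n.+1%:R)) n.+1).[x].
    apply: bernstein_le => // k /key; rewrite /lo distrC ler_distl mulNr.
    by rewrite opprD addrA => /andP[].
  apply: le_trans; rewrite /lo bernstein_quadratic mulNr -addrA -opprD.
  by rewrite lerB.
- pose up k : R := (f x + e / 2) + 2 * M / d ^+ 2 / n.+1%:R ^+ 2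
                                   * (k%:R - n.+1%:R * x) ^+ 2.
  have : (bernstein (fun k => f (k%:R / n.+1%:R)) n.+1).[x] <=
         (bernstein up n.+1).[x].
    apply: bernstein_le => // k /key; rewrite /up distrC ler_distl.
    by rewrite addrA => /andP[].
  move/le_trans; apply; rewrite /up bernstein_quadratic -addrA.
  by rewrite lerD.
Qed.

Lemma weierstrass L f : 0 < L -> continuous f -> forall e, 0 < e ->
  exists q : {poly R}, forall x, - L <= x <= L -> `|f x - q.[x]| <= e.
Proof.
move=> L0 cf e e0.
have cg : continuous (fun t : R => f (2 * L * t - L)).
  move=> t; apply: (@continuous_comp _ _ _ (fun t : R => 2 * L * t - L)).
    by apply: cvgB; [apply: cvgM; [exact: cvg_cst|]|exact: cvg_cst].
  exact: cf.
have [q Hq] := weierstrass01 cg e0.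
exists (q \Po (('X + L%:P) * ((2 * L)^-1)%:P)) => x /andP[xL1 xL2].
have := Hq ((x + L) / (2 * L)).
rewrite horner_comp hornerM hornerD hornerX !hornerC.
have -> : 2 * L * ((x + L) / (2 * L)) - L = x by field; rewrite gt_eqF.
apply; rewrite divr_ge0 ?mulr_ge0//=; [|lra|exact: ltW].
by rewrite ler_pdivrMr ?mulr_gt0//; lra.
Qed.

End weierstrass.

(** * Positive functionals of total mass one *)

Section positive_functionals.
Variable R : realType.
Implicit Types (f g : R -> R) (L : R).

(** Testing positivity only on [-L, L] expresses that A is carried by that
    segment. *)
Definition positive_mean L (A : (R -> R) -> R) :=
  [/\ forall f g, continuous f -> continuous g ->
        A (fun x => f x + g x) = A f + A g,
      forall c f, continuous f -> A (fun x => c * f x) = c * A f,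
      forall f, continuous f -> (forall x, `|x| <= L -> 0 <= f x) -> 0 <= A f &
      A (cst 1) = 1].

Lemma continuousMf f g : continuous f -> continuous g ->
  continuous (fun x => f x * g x).
Proof. by move=> cf cg x; apply: cvgM; [exact: cf|exact: cg]. Qed.

Lemma continuousZf c f : continuous f -> continuous (fun x => c * f x).
Proof. by move=> cf; apply: continuousMf => // x; exact: cvg_cst. Qed.

Lemma continuousDf f g : continuous f -> continuous g ->
  continuous (fun x => f x + g x).
Proof. by move=> cf cg x; apply: cvgD; [exact: cf|exact: cg]. Qed.

Lemma continuous_cst (c : R) : continuous (fun _ : R => c).
Proof. by move=> x; exact: cvg_cst. Qed.

Section one_mean.
Variables (L : R) (A : (R -> R) -> R).
Hypothesis meanA : positive_mean L A.

Lemma meanD f g : continuous f -> continuous g ->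
  A (fun x => f x + g x) = A f + A g.
Proof. by have [+ _ _ _] := meanA; exact. Qed.

Lemma meanZ c f : continuous f -> A (fun x => c * f x) = c * A f.
Proof. by have [_ + _ _] := meanA; exact. Qed.

Lemma meanB f g : continuous f -> continuous g ->
  A (fun x => f x - g x) = A f - A g.
Proof.
move=> cf cg.
have -> : (fun x => f x - g x) = fun x => f x + (-1) * g x.
  by apply/funext => x; rewrite mulN1r.
by rewrite meanD ?meanZ ?mulN1r//; exact: continuousZf.
Qed.

Lemma mean_cst c : A (fun=> c) = c.
Proof.
have [_ _ _ A1] := meanA.
rewrite -[RHS]mulr1 -A1 -meanZ; last exact: continuous_cst.
by congr A; apply/funext => x; rewrite mulr1.
Qed.

Lemma mean_le f g : continuous f -> continuous g ->
  (forall x, `|x| <= L -> f x <= g x) -> A f <= A g.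
Proof.
move=> cf cg fg; rewrite -subr_ge0 -meanB//.
have [_ _ + _] := meanA; apply.
  by move=> x; apply: cvgB; [exact: cg|exact: cf].
by move=> x xL; rewrite subr_ge0 fg.
Qed.

Lemma mean_dist f g e : continuous f -> continuous g ->
  (forall x, `|x| <= L -> `|f x - g x| <= e) -> `|A f - A g| <= e.
Proof.
move=> cf cg fg; have ce := @continuous_cst e.
have cN : continuous (fun _ : R => - e) by exact: continuous_cst.
rewrite ler_distl; apply/andP; split.
- rewrite -[e in A g - e]mean_cst -meanB//; apply: mean_le => //.
    exact: continuousDf.
  by move=> x /fg; rewrite ler_distl => /andP[].
- rewrite -[e in A g + e]mean_cst -meanD//; apply: mean_le => //.
    exact: continuousDf.
  by move=> x /fg; rewrite ler_distl => /andP[].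
Qed.

Lemma mean_poly (q : {poly R}) :
  A (fun x => q.[x]) = \sum_(i < size q) q`_i * A (fun x => x ^+ i).
Proof.
have cX i : continuous (fun x : R => x ^+ i) by exact: exprn_continuous.
have -> : (fun x => q.[x]) = fun x => \sum_(i < size q) q`_i * x ^+ i.
  by apply/funext => x; rewrite horner_coef.
elim: (size q) => [|n IH].
  rewrite big_ord0 -[RHS]mean_cst; congr A; apply/funext => x.
  by rewrite big_ord0.
rewrite big_ord_recr /= -IH -meanZ// -meanD//; last exact: continuousZf.
  by congr A; apply/funext => x; rewrite big_ord_recr.
elim: n {IH} => [|n IH].
  by under eq_fun do rewrite big_ord0; exact: continuous_cst.
under eq_fun do rewrite big_ord_recr/=.
by apply: continuousDf => //; exact: continuousZf.
Qed.

End one_mean.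

Lemma positive_meanW L L' A : L <= L' ->
  positive_mean L A -> positive_mean L' A.
Proof.
move=> LL' [AD AZ A0 A1]; split => // f cf f0; apply: A0 => // x xL.
by apply: f0; exact: le_trans LL'.
Qed.

Lemma positive_mean_ext L A B : (forall f, continuous f -> B f = A f) ->
  positive_mean L A -> positive_mean L B.
Proof.
move=> BA [AD AZ A0 A1]; split.
- by move=> f g cf cg; rewrite !BA//; [exact: AD|exact: continuousDf].
- by move=> c f cf; rewrite !BA//; [exact: AZ|exact: continuousZf].
- by move=> f cf; rewrite BA//; exact: A0.
- by rewrite BA//; exact: continuous_cst.
Qed.

Lemma positive_mean_convex L n (w : nat -> R) (A : nat -> (R -> R) -> R) :
  (forall k, (k < n)%N -> 0 <= w k) -> \sum_(k < n) w k = 1 ->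
  (forall k, (k < n)%N -> positive_mean L (A k)) ->
  positive_mean L (fun f => \sum_(k < n) w k * A k f).
Proof.
move=> w0 w1 mA; split.
- move=> f g cf cg; rewrite -big_split; apply: eq_bigr => k _ /=.
  by rewrite (meanD (mA _ (ltn_ord k)))// mulrDr.
- move=> c f cf; rewrite mulr_sumr; apply: eq_bigr => k _.
  by rewrite (meanZ (mA _ (ltn_ord k)))// mulrCA.
- move=> f cf f0; apply: sumr_ge0 => k _; rewrite mulr_ge0 ?w0//.
  by have [_ _ + _] := mA _ (ltn_ord k); exact.
- rewrite -[RHS]w1; apply: eq_bigr => k _.
  by rewrite (mean_cst (mA _ (ltn_ord k))) mulr1.
Qed.

(** A functional of mass 1 moves by at most e when its argument is
    perturbed by e on [-L, L]; with a Weierstrass approximation of f this makes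
    A n f a Cauchy sequence. *)
Lemma cvg_mean_moments L (A : nat -> (R -> R) -> R) : 0 < L ->
  (forall n, positive_mean L (A n)) ->
  (forall m, cvgn (fun n => A n (fun x => x ^+ m))) ->
  forall f, continuous f -> cvgn (fun n => A n f).
Proof.
move=> L0 mA cA f cf; apply/cauchy_cvgP/cauchy_exP => e e0.
have [q fq] := weierstrass L0 cf (divr_gt0 e0 (@ltr0n R 2)).
have cq : continuous (fun x => q.[x]) by exact: continuous_horner.
have /cvg_ex[l ql] : cvgn (fun n => A n (fun x => q.[x])).
  under eq_fun do rewrite (mean_poly (mA _)).
  elim: (size q) => [|m IH].
    by under eq_fun do rewrite big_ord0; exact: is_cvg_cst.
  under eq_fun do rewrite big_ord_recr/=.
  by apply: is_cvgD => //; apply: is_cvgM; [exact: is_cvg_cst|exact: cA].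
exists l; suff : \forall n \near \oo, `|l - A n f| < e by [].
near=> n.
rewrite -(subrKA (A n (fun x => q.[x]))) (le_lt_trans (ler_normD _ _))//.
rewrite [ltRHS]splitr ltr_leD//.
  near: n; move/cvgrPdist_lt : ql; apply; exact: divr_gt0.
rewrite distrC; apply: (mean_dist (mA n)) => // x.
by rewrite ler_norml; exact: fq.
Unshelve. all: by end_near. Qed.

Lemma positive_mean_lim L (A : nat -> (R -> R) -> R) :
  (forall n, positive_mean L (A n)) ->
  (forall f, continuous f -> cvgn (fun n => A n f)) ->
  positive_mean L (fun f => limn (fun n => A n f)).
Proof.
move=> mA cA; split.
- move=> f g cf cg; rewrite -limD; [|exact: cA..].
  by congr (limn _); apply/funext => n /=; rewrite (meanD (mA n)).
- move=> c f cf; apply/cvg_lim => //.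
  under eq_fun do rewrite (meanZ (mA _))//.
  by apply: cvgM; [exact: cvg_cst|exact: cA].
- move=> f cf f0; apply: limr_ge; first exact: cA.
  by apply: nearW => n; have [_ _ + _] := mA n; exact.
- apply/cvg_lim => //; under eq_fun do rewrite (mean_cst (mA _)).
  exact: cvg_cst.
Qed.

End positive_functionals.

(** * Integration against a measure carried by a segment *)

Section compactly_supported_measure.
Variable R : realType.
Variable m : {finite_measure set (measurableTypeR R) -> \bar R}.
Variables u v : R.
Hypothesis m0 : m (~` `[u, v]%classic) = 0%E.
Implicit Types f g : R -> R.

Let mitv : measurable (`[u, v]%classic : set (measurableTypeR R)).
Proof. exact: measurable_itv. Qed.

Lemma continuous_measurable_RR f : continuous f ->
  measurable_fun setT (f : measurableTypeR R -> R).
Proof. by move=> cf; exact: continuous_measurable_fun. Qed.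

Lemma continuous_integrable f : continuous f ->
  m.-integrable setT (EFin \o f).
Proof.
move=> cf; have mf := continuous_measurable_RR cf.
apply/(@negligible_integrable _ _ _ m setT (~` `[u, v]%classic)) => //.
- exact: measurableC.
- exact/measurable_EFinP.
rewrite setTD setCK; apply: measurable_bounded_integrable => //.
- by rewrite (le_lt_trans (le_measure m _ _ (@subsetT _ _))) ?inE//;
    exact: fin_num_fun_lty.
- exact: measurable_funTS.
have /compact_bounded : compact (f @` `[u, v]).
  apply: continuous_compact; last exact: segment_compact.
  exact: continuous_subspaceT.
move=> [M [Mr HM]]; exists M; split => // r Mr' x xuv /=.
by apply: HM Mr' _ _; exists x.
Qed.

Lemma Rintegral_segment f : continuous f ->
  \int[m]_x f x = \int[m]_(x in `[u, v]) f x.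
Proof.
move=> cf; rewrite /Rintegral (@negligible_integral _ _ _ m setT (~` `[u, v]))//.
- by rewrite setTD setCK.
- exact: measurableC.
- exact: continuous_integrable.
Qed.

Lemma Rintegral_contD f g : continuous f -> continuous g ->
  \int[m]_x (f x + g x) = \int[m]_x f x + \int[m]_x g x.
Proof. by move=> *; rewrite RintegralD//; exact: continuous_integrable. Qed.

Lemma Rintegral_contZ c f : continuous f ->
  \int[m]_x (c * f x) = c * \int[m]_x f x.
Proof. by move=> *; rewrite RintegralZl//; exact: continuous_integrable. Qed.

End compactly_supported_measure.

Lemma positive_mean_density (R : realType)
    (m : {finite_measure set (measurableTypeR R) -> \bar R}) L (g : R -> R) :
  m (~` `[- L, L]%classic) = 0%E -> continuous g -> (forall x, 0 <= g x) ->
  \int[m]_x g x = 1 ->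
  positive_mean L (fun f => \int[m]_x (f x * g x)).
Proof.
move=> m0 cg g0 g1; split.
- move=> f h cf ch; rewrite -(Rintegral_contD m0); [|exact: continuousMf..].
  by apply: eq_Rintegral => x _; rewrite mulrDl.
- move=> c f cf; rewrite -(Rintegral_contZ m0); last exact: continuousMf.
  by apply: eq_Rintegral => x _; rewrite mulrA.
- move=> f cf f0; rewrite (Rintegral_segment m0); last exact: continuousMf.
  apply: Rintegral_ge0 => x /=; rewrite in_itv/= -ler_norml => xL.
  by rewrite mulr_ge0// f0.
- by under eq_Rintegral do rewrite mul1r.
Qed.

Lemma positive_mean_probability (R : realType)
    (P : probability (measurableTypeR R) R) L :
  P (~` `[- L, L]%classic) = 0%E ->
  positive_mean L (fun f => \int[P]_x f x).
Proof.
move=> P0.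
have -> : (fun f => \int[P]_x f x) = (fun f : R -> R => \int[P]_x (f x * 1)).
  by apply/funext => f; apply: eq_Rintegral => x _; rewrite mulr1.
apply: positive_mean_density => //; first exact: continuous_cst.
by rewrite Rintegral_cst//= probability_setT mulr1.
Qed.

(** * Ramps and piecewise linear interpolation *)

Section ramp.
Variable R : realType.
Implicit Types x y h t : R.

(** The continuous function equal to 1 before x, to 0 after x + h, and affine
    in between. *)
Definition ramp x h t : R := Num.min 1 (Num.max 0 ((x + h - t) / h)).

Lemma continuous_ramp x h : continuous (ramp x h).
Proof.
have cc (c : R) : continuous (fun _ : R => c) by move=> t; exact: cvg_cst.
move=> t; apply: (@continuous_min _ _ (fun=> 1)
  (fun t => Num.max 0 ((x + h - t) / h))); first exact: cc.
apply: (@continuous_max _ _ (fun=> 0) (fun t => (x + h - t) / h)).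
  exact: cc.
by apply: cvgM; [apply: cvgB; [exact: cc|]|exact: cc].
Qed.

Lemma ramp_ge0 x h t : 0 <= ramp x h t.
Proof. by rewrite le_min ler01/= le_max lexx. Qed.

Lemma ramp_le1 x h t : ramp x h t <= 1.
Proof. by rewrite ge_min lexx. Qed.

Lemma ramp_eq1 x h t : 0 < h -> t <= x -> ramp x h t = 1.
Proof.
move=> h0 tx; rewrite /ramp; apply/min_idPl.
by rewrite le_max ler_pdivlMr// mul1r; apply/orP; right; lra.
Qed.

Lemma ramp_eq0 x h t : 0 < h -> x + h <= t -> ramp x h t = 0.
Proof.
move=> h0 xt; rewrite /ramp (_ : Num.max _ _ = 0) ?min_r//.
by apply/max_idPl; rewrite ler_pdivrMr// mul0r; lra.
Qed.

Lemma le_ramp x y h t : 0 < h -> x <= y -> ramp x h t <= ramp y h t.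
Proof.
move=> h0 xy; rewrite /ramp le_min ge_min lexx/= ge_min.
apply/orP; right; rewrite ge_max !le_max lexx/=; apply/orP; right.
by rewrite ler_pM2r ?invr_gt0//; lra.
Qed.

Lemma ramp_shift x y h t : 0 < h -> x <= y ->
  ramp y h t <= ramp x h t + (y - x) / h.
Proof.
move=> h0 xy.
have d0 : 0 <= (y - x) / h by rewrite divr_ge0// ?subr_ge0// ltW.
have E : (y + h - t) / h = (x + h - t) / h + (y - x) / h.
  by rewrite -mulrDl; congr (_ / _); ring.
rewrite /ramp E; set a := (x + h - t) / h; set b := (y - x) / h in d0 *.
case: (leP 1 (Num.max 0 a)) => _; rewrite ge_min; first by rewrite lerDl d0.
apply/orP; right; rewrite ge_max lerD2r le_max lexx orbT andbT.
by rewrite addr_ge0// le_max lexx.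
Qed.

End ramp.

Section uniqueness.
Variable R : realType.
Implicit Types (f : R -> R) (x h t : R).

(** The piecewise linear interpolation of f at the nodes x0 + i h, i <= n,
    built by adding one increment of f per node. *)
Fixpoint interpolation f x0 h n t : R :=
  if n is m.+1 then
    interpolation f x0 h m t + (f (x0 + m.+1%:R * h) - f (x0 + m%:R * h)) *
                               (1 - ramp (x0 + m%:R * h) h t)
  else f x0.

Lemma continuous_interpolation f x0 h n :
  continuous (interpolation f x0 h n).
Proof.
elim: n => [|n IH] /=; first exact: continuous_cst.
apply: continuousDf => //; apply: continuousZf => t.
by apply: cvgB; [exact: cvg_cst|exact: continuous_ramp].
Qed.

Lemma interpolation_right f x0 h n t : 0 < h -> x0 + n%:R * h <= t ->
  interpolation f x0 h n t = f (x0 + n%:R * h).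
Proof.
move=> h0; elim: n => [|n IH]; first by rewrite mul0r addr0.
rewrite -natr1 mulrDl mul1r addrA => nt /=.
rewrite IH; last by rewrite (le_trans _ nt)// lerDl ltW.
by rewrite ramp_eq0// subr0 mulr1 subrKC -natr1 mulrDl mul1r addrA.
Qed.

Lemma interpolation_dist f x0 h n e : 0 < h ->
  (forall x y, x0 <= x <= x0 + n%:R * h -> x0 <= y <= x0 + n%:R * h ->
     `|x - y| <= h -> `|f x - f y| <= e) ->
  forall t, x0 <= t <= x0 + n%:R * h ->
    `|interpolation f x0 h n t - f t| <= e + e.
Proof.
move=> h0; elim: n => [|n IH] fe t.
  rewrite mul0r addr0 => t0; have <- : x0 = t by apply/le_anti.
  rewrite subrr normr0; have := fe x0 x0.
  by rewrite mul0r addr0 lexx !subrr !normr0 ltW// => /(_ erefl erefl erefl); lra.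
have xS : x0 + n.+1%:R * h = x0 + n%:R * h + h.
  by rewrite -natr1 mulrDl mul1r addrA.
have xn : x0 <= x0 + n%:R * h by rewrite lerDl mulr_ge0// ltW.
rewrite /= xS in fe * => /andP[t0 tn].
have [tx|xt] := leP t (x0 + n%:R * h).
  rewrite ramp_eq1// subrr mulr0 addr0; apply: IH; last by rewrite t0.
  move=> x y /andP[xx1 xx2] /andP[yx1 yx2]; apply: fe.
    by rewrite xx1 (le_trans xx2)// lerDl ltW.
  by rewrite yx1 (le_trans yx2)// lerDl ltW.
rewrite interpolation_right//; last exact: ltW.
rewrite addrAC (le_trans (ler_normD _ _))// lerD//.
  apply: fe; first by rewrite xn lerDl ltW.
    by rewrite t0.
  by rewrite distrC ger0_norm; lra.
rewrite normrM -[leRHS]mulr1 ler_pM//.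
  apply: fe; [by rewrite lexx andbT (le_trans xn)// lerDl ltW| |].
    by rewrite xn lerDl ltW.
  by rewrite addrAC subrr add0r gtr0_norm.
have := ramp_ge0 (x0 + n%:R * h) h t; have := ramp_le1 (x0 + n%:R * h) h t.
by move=> *; rewrite ger0_norm; lra.
Qed.

(** Both functionals send the ramp from x to x + h into [F x, F (x + h)], so
    they differ on it by at most F (x + h) - F x.  On the interpolation of f
    with increments at most e these differences add up to a telescoping sum,
    at most e (F L - F (- L)) <= e; and the interpolation is uniformly
    close to f. *)
Lemma mean_unique L (A B : (R -> R) -> R) (F : R -> R) : 0 < L ->
  positive_mean L A -> positive_mean L B ->
  (forall x, 0 <= F x <= 1) ->
  (forall x h, 0 < h -> F x <= A (ramp x h) <= F (x + h)) ->
  (forall x h, 0 < h -> F x <= B (ramp x h) <= F (x + h)) ->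
  forall f, continuous f -> A f = B f.
Proof.
move=> L0 mA mB F01 FA FB f cf.
suff H e : 0 < e -> `|A f - B f| <= 5 * e.
  apply/eqP; rewrite -subr_eq0 -normr_le0; apply/ler_addgt0Pr => e e0.
  have e50 : 0 < e / 5 by rewrite divr_gt0.
  by rewrite add0r (le_trans (H _ e50))//; lra.
move=> e0.
have [d d0 fd] := @unif_continuous_itv _ f (- L) L cf _ e0.
have [n n_gt] : exists n, 2 * L / d < n.+1%:R.
  by exists (Num.truncn (2 * L / d)); exact: truncnS_gt.
have n0 : 0 < n.+1%:R :> R by [].
pose h := 2 * L / n.+1%:R.
have h0 : 0 < h by rewrite divr_gt0// mulr_gt0.
have hd : h < d by rewrite /h ltr_pdivrMr// [ltRHS]mulrC -ltr_pdivrMr.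
have xn : - L + n.+1%:R * h = L.
  by rewrite /h mulrCA divff ?mulr1 ?gt_eqF//; ring.
pose s := interpolation f (- L) h n.+1.
have cs : continuous s by exact: continuous_interpolation.
have fs x : `|x| <= L -> `|f x - s x| <= e + e.
  move=> xL; rewrite distrC; apply: interpolation_dist => //; last first.
    by rewrite xn -ler_norml.
  move=> y z; rewrite xn => yL zL yz.
  by apply/ltW/fd => //; exact: le_lt_trans hd.
have key m : (m <= n.+1)%N ->
    `|A (interpolation f (- L) h m) - B (interpolation f (- L) h m)| <=
    e * (F (- L + m%:R * h) - F (- L)).
  elim: m => [|m IH] mn.
    by rewrite /= (mean_cst mA) (mean_cst mB) subrr normr0 mul0r addr0 subrr mulr0.
  set x := - L + m%:R * h.
  have xS : - L + m.+1%:R * h = x + h by rewrite -natr1 mulrDl mul1r addrA.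
  have c1 : continuous (fun t => 1 - ramp x h t).
    by move=> t; apply: cvgB; [exact: cvg_cst|exact: continuous_ramp].
  have ci : continuous (interpolation f (- L) h m).
    exact: continuous_interpolation.
  have E C : positive_mean L C -> C (interpolation f (- L) h m.+1) =
     C (interpolation f (- L) h m) + (f (x + h) - f x) * (1 - C (ramp x h)).
    move=> mC; rewrite /= xS (meanD mC)//; last exact: continuousZf.
    rewrite (meanZ mC)// (meanB mC) ?(mean_cst mC)//.
      exact: continuous_cst.
    exact: continuous_ramp.
  rewrite (E A)// (E B)//.
  have -> : forall a b c u v : R, a + c * (1 - u) - (b + c * (1 - v)) =
     (a - b) + c * (v - u) by move=> *; ring.
  rewrite (le_trans (ler_normD _ _))// xS.
  have -> : e * (F (x + h) - F (- L)) =
    e * (F x - F (- L)) + e * (F (x + h) - F x) by ring.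
  rewrite lerD ?IH ?(ltnW mn)// normrM ler_pM//.
    have m0 : 0 <= m%:R * h by rewrite mulr_ge0// ltW.
    have mh : m%:R * h + h <= 2 * L.
      have -> : m%:R * h + h = m.+1%:R * h by rewrite -natr1 mulrDl mul1r.
      rewrite -(_ : n.+1%:R * h = 2 * L).
        by rewrite ler_pM2r// ler_nat.
      by move: xn; lra.
    apply/ltW/fd; rewrite /x; [lra|lra|].
    by rewrite addrAC subrr add0r gtr0_norm.
  have /andP[a1 a2] := FA x h h0; have /andP[b1 b2] := FB x h h0.
  by rewrite ler_norml; lra.
have := key n.+1 (leqnn _); rewrite xn -/s => ABs.
have := mean_dist mA cf cs fs; have := mean_dist mB cf cs fs => Bs As.
have F1 : e * (F L - F (- L)) <= e.
  rewrite -[leRHS]mulr1 ler_pM2l//.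
  by have := F01 L; have := F01 (- L); lra.
have -> : A f - B f = (A f - A s) + ((A s - B s) - (B f - B s)) by ring.
rewrite (le_trans (ler_normD _ _))//.
have := ler_normB (A s - B s) (B f - B s).
lra.
Qed.

End uniqueness.

(** * Representing measures and the method of moments *)

Section riesz.
Variables (R : realType) (L : R) (A : (R -> R) -> R).
Hypothesis (L0 : 0 < L) (mA : positive_mean L A).
Implicit Types (x h : R).

(** The candidate distribution function: the ramps starting at x decrease to
    the indicator of ]-oo, x] as their width h decreases to 0. *)
Let F x : R := inf [set A (ramp x h) | h in [set h : R | 0 < h]].

Let ramp_ge0A x h : 0 <= A (ramp x h).
Proof.
have [_ _ + _] := mA; apply; first exact: continuous_ramp.
by move=> t _; exact: ramp_ge0.
Qed.

Let F_le x h : 0 < h -> F x <= A (ramp x h).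
Proof.
move=> h0; apply: ge_inf; last by exists h.
by exists 0 => _ [k _ <-]; exact: ramp_ge0A.
Qed.

Let F_ge x (c : R) : (forall h, 0 < h -> c <= A (ramp x h)) -> c <= F x.
Proof.
move=> H; apply: lb_le_inf; last by move=> _ [h h0 <-]; exact: H.
by exists (A (ramp x 1)); exists 1 => //=; exact: ltr01.
Qed.

Let F_ramp x h : 0 < h -> A (ramp x h) <= F (x + h).
Proof.
move=> h0; apply: F_ge => k k0.
apply: (mean_le mA); [exact: continuous_ramp..|move=> t _].
have [xt|tx] := leP (x + h) t; first by rewrite (@ramp_eq0 _ x)// ramp_ge0.
by rewrite (@ramp_eq1 _ (x + h))// ?ramp_le1// ltW.
Qed.

Let F_ge0 x : 0 <= F x.
Proof. by apply: F_ge => h _. Qed.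

Let F_le1 x : F x <= 1.
Proof.
rewrite (le_trans (F_le x ltr01))// -[leRHS](mean_cst mA).
apply: (mean_le mA); [exact: continuous_ramp|exact: continuous_cst|].
by move=> t _; exact: ramp_le1.
Qed.

Let F_left x : x < - L -> F x = 0.
Proof.
move=> xL; apply/le_anti; rewrite F_ge0 andbT.
have h0 : 0 < - L - x by lra.
rewrite (le_trans (F_le x h0))// -[leRHS](mean_cst mA).
apply: (mean_le mA); [exact: continuous_ramp|exact: continuous_cst|].
by move=> t; rewrite ler_norml => /andP[? _]; rewrite ramp_eq0//; lra.
Qed.

Let F_right x : L <= x -> F x = 1.
Proof.
move=> xL; apply/le_anti; rewrite F_le1/=; apply: F_ge => h h0.
rewrite -[leLHS](mean_cst mA).
apply: (mean_le mA); [exact: continuous_cst|exact: continuous_ramp|].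
by move=> t; rewrite ler_norml => /andP[_ ?]; rewrite ramp_eq1//; lra.
Qed.

Let F_nd : nondecreasing F.
Proof.
move=> x y xy; apply: F_ge => h h0; rewrite (le_trans (F_le x h0))//.
apply: (mean_le mA); [exact: continuous_ramp..|move=> t _].
exact: le_ramp.
Qed.

(** A near-optimal width h at x is also near-optimal at nearby points y > x,
    because translating the ramp by y - x changes it by at most (y - x) / h. *)
Let F_rc : right_continuous F.
Proof.
move=> x; apply/cvgrPdist_le => e e0.
have e20 : 0 < e / 2 by rewrite divr_gt0.
have [_ [h /= h0 <-] Ah] : exists2 r, [set A (ramp x h) | h in [set h : R | 0 < h]] r
    & r < F x + e / 2.
  apply: inf_adherent => //; split.
    by exists (A (ramp x 1)); exists 1 => //=; exact: ltr01.
  by exists 0 => _ [k _ <-]; exact: ramp_ge0A.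
near=> y.
have xy : x < y by near: y; exact: nbhs_right_gt.
have yx : y < x + h * (e / 2).
  by near: y; apply: nbhs_right_lt; rewrite ltrDl mulr_gt0.
rewrite distrC ger0_norm ?subr_ge0 ?F_nd 1?ltW//.
have yh : (y - x) / h <= e / 2.
  by rewrite ler_pdivrMr// [leRHS]mulrC lerBlDl ltW.
have : A (ramp y h) <= A (ramp x h) + (y - x) / h.
  rewrite -[in leRHS](mean_cst mA ((y - x) / h)) -(meanD mA); last 2 first.
  - exact: continuous_ramp.
  - exact: continuous_cst.
  apply: (mean_le mA); first exact: continuous_ramp.
    by apply: continuousDf; [exact: continuous_ramp|exact: continuous_cst].
  by move=> t _; apply: ramp_shift => //; exact: ltW.
have := F_le y h0.
lra.
Unshelve. all: by end_near. Qed.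

Let F_Ny : F @ -oo --> (0 : R).
Proof.
apply: cvg_near_cst; near=> x; apply: F_left.
by near: x; apply: nbhs_ninfty_lt; exact: num_real.
Unshelve. all: by end_near. Qed.

Let F_y : F @ +oo --> (1 : R).
Proof.
apply: cvg_near_cst; near=> x; apply: F_right.
by near: x; apply: nbhs_pinfty_ge; exact: num_real.
Unshelve. all: by end_near. Qed.

#[local] HB.instance Definition _ := isCumulative.Build R _ R F F_nd F_rc.
#[local] HB.instance Definition _ := isCumulativeBounded.Build R 0 1 F F_Ny F_y.

Let P : probability (measurableTypeR R) R := lebesgue_stieltjes_measure F.

Let idTR : measurableTypeR R -> R := idfun.

#[local] HB.instance Definition _ :=
  @isMeasurableFun.Build _ _ _ _ idTR (@measurable_id _ _ setT).

Let P_itv x : P `]-oo, x]%classic = (F x)%:E.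
Proof.
rewrite -(@cdf_lebesgue_stieltjes_id R F x).
by rewrite /cdf /distribution /pushforward preimage_id.
Qed.

Let P0 : P (~` `[- (L + 1), L + 1]%classic) = 0%E.
Proof.
apply/eqP; rewrite eq_le measure_ge0 andbT.
have sub : ~` `[- (L + 1), L + 1]%classic `<=`
   `]-oo, - (L + 1)]%classic `|` ~` `]-oo, L + 1]%classic.
  move=> t /=; rewrite !in_itv/= => /negP; rewrite negb_and -!ltNge.
  by move=> /orP[/ltW|]; [left|right; apply/negP; rewrite -ltNge].
apply: (le_trans (le_measure P _ _ sub)).
- by rewrite inE; apply: measurableC; exact: measurable_itv.
- by rewrite inE; apply: measurableU; [|apply: measurableC]; exact: measurable_itv.
have mN : measurable (`]-oo, - (L + 1)]%classic : set (measurableTypeR R)).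
  exact: measurable_itv.
have mP : measurable (`]-oo, L + 1]%classic : set (measurableTypeR R)).
  exact: measurable_itv.
have PN : P `]-oo, - (L + 1)]%classic = 0%E by rewrite P_itv F_left//; lra.
have PC : P (~` `]-oo, L + 1]%classic) = 0%E.
  have := @probability_setC _ _ _ P _ mP.
  by have := P_itv (L + 1); rewrite F_right; [move=> -> ->; rewrite subee|lra].
apply: (le_trans (measureU2 P mN (measurableC mP))).
suff : (P `]-oo, (- (L + 1))%R]%classic + P (~` `]-oo, (L + 1)%R]%classic) <= 0)%E.
  exact.
by rewrite PN PC adde0.
Qed.

(** The Lebesgue-Stieltjes measure of F represents A by mean_unique: like A,
    it sends the ramp from x to x + h into [F x, F (x + h)], since that ramp
    lies between the indicators of ]-oo, x] and ]-oo, x + h].  The segment is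
    enlarged by 1 because F may jump at - L, so that F vanishes only to the
    left of - L. *)
Lemma riesz_representation : exists P : probability (measurableTypeR R) R,
  P (~` `[- (L + 1), L + 1]%classic) = 0%E /\
  forall f, continuous f -> A f = \int[P]_x f x.
Proof.
exists P; split => // f cf.
have L10 : 0 < L + 1 by rewrite addr_gt0.
have mP := positive_mean_probability P0.
have FA x h : 0 < h -> F x <= A (ramp x h) <= F (x + h).
  by move=> h0; rewrite F_le// F_ramp.
have mitv x : measurable (`]-oo, x]%classic : set (measurableTypeR R)).
  exact: measurable_itv.
have indic x : P.-integrable setT (EFin \o \1_(`]-oo, x]%classic)) /\
    \int[P]_t (\1_(`]-oo, x]%classic) t) = F x.
  have e := congr1 fine (P_itv x).
  split; first exact: integrable_indic.
  by rewrite /Rintegral integral_indic// setIT; exact: e.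
apply: (mean_unique L10 _ mP _ FA) => //.
- by apply: positive_meanW mA; rewrite lerDl.
- by move=> x; rewrite F_ge0 F_le1.
move=> x h h0; have [i1 <-] := indic x; have [i2 <-] := indic (x + h).
have ir := continuous_integrable P0 (@continuous_ramp _ x h).
apply/andP; split; apply: le_Rintegral => // t _; rewrite indicE.
- have [tx|_] := boolP (t \in `]-oo, x]%classic); last exact: ramp_ge0.
  by rewrite ramp_eq1//; move: tx; rewrite inE/= in_itv.
- have [_|] := boolP (t \in `]-oo, x + h]%classic); first exact: ramp_le1.
  by rewrite notin_setE/= in_itv/= => /negP; rewrite -ltNge => /ltW ?; rewrite ramp_eq0.
Qed.

End riesz.

Lemma method_of_moments (R : realType) (L : R) (A : nat -> (R -> R) -> R) :
  0 < L -> (forall n, positive_mean L (A n)) ->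
  (forall m, cvgn (fun n => A n (fun x => x ^+ m))) ->
  exists P : probability (measurableTypeR R) R,
    P (~` `[- (L + 1), L + 1]%classic) = 0%E /\
    forall f, continuous f -> A n f @[n --> \oo] --> \int[P]_x f x.
Proof.
move=> L0 mA cX; have cA := cvg_mean_moments L0 mA cX.
have [P [P0 PA]] := riesz_representation L0 (positive_mean_lim mA cA).
by exists P; split => // f cf; rewrite -PA//; exact: cA.
Qed.

(** * Powers of the Jacobi matrix *)

Section jacobi.
Variables (R : realType) (nu : {finite_measure set (measurableTypeR R) -> \bar R}).
Variables (p : nat -> {poly R}) (a b : nat -> R) (u v M : R).
Hypotheses (nu0 : nu (~` `[u, v]%classic) = 0%E).
Hypotheses (orth : orthonormal_polys nu p) (jac : jacobi_coefs p a b).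

(** The (k, i) entry of the m-th power of the Jacobi matrix of nu, that is, the
    coefficient of p i in the expansion of x^m p_k. *)
Definition jacobi_power m k i : R :=
  \int[nu]_x (x ^+ m * (p k).[x] * (p i).[x]).

Let c3 m k i : continuous (fun x : R => x ^+ m * (p k).[x] * (p i).[x]).
Proof.
apply: continuousMf; last exact: continuous_horner.
by apply: continuousMf; [exact: exprn_continuous|exact: continuous_horner].
Qed.

Lemma jacobi_power0 k i : jacobi_power 0 k i = (k == i)%:R.
Proof.
have [_ _ <-] := orth; apply: eq_Rintegral => x _.
by rewrite expr0 mul1r.
Qed.

Lemma jacobi_powerS m k i : jacobi_power m.+1 k i =
  b i.+1 * jacobi_power m k i.+1 + a i * jacobi_power m k i +
  b i * (if i is j.+1 then jacobi_power m k j else 0).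
Proof.
have [_ _ /(_ i) rec] := jac.
pose prev x := x ^+ m * (p k).[x] * (prev_poly p i).[x].
have cprev : continuous prev.
  apply: continuousMf; last exact: continuous_horner.
  by apply: continuousMf; [exact: exprn_continuous|exact: continuous_horner].
have -> : (if i is j.+1 then jacobi_power m k j else 0) = \int[nu]_x prev x.
  rewrite /prev; case: (i) => [|j]//=.
  under eq_Rintegral do rewrite horner0 mulr0.
  by rewrite Rintegral_cst//= mul0r.
rewrite -!(Rintegral_contZ nu0)// -!(Rintegral_contD nu0);
  [|by do ?apply: continuousDf; exact: continuousZf..].
apply: eq_Rintegral => x _.
have := congr1 (fun q => q.[x]) rec.
rewrite !hornerD !hornerZ hornerM hornerX => E.
have -> : x ^+ m.+1 * (p k).[x] * (p i).[x] =
  x ^+ m * (p k).[x] * (x * (p i).[x]) by rewrite exprSr; ring.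
by rewrite E /prev; ring.
Qed.

Hypotheses (M0 : 0 <= M) (aM : forall k, `|a k| <= M) (bM : forall k, `|b k| <= M).

Lemma jacobi_power_bound m k i : `|jacobi_power m k i| <= (3 * M) ^+ m.
Proof.
elim: m i => [|m IH] i.
  by rewrite jacobi_power0 expr0; case: eqP => _; rewrite ?normr1 ?normr0.
have M3 : 0 <= (3 * M) ^+ m by rewrite exprn_ge0// mulr_ge0.
have bd (c y : R) : `|c| <= M -> `|y| <= (3 * M) ^+ m ->
   `|c * y| <= M * (3 * M) ^+ m.
  by move=> cM yM; rewrite normrM ler_pM.
rewrite jacobi_powerS exprS.
have -> : 3 * M * (3 * M) ^+ m =
  M * (3 * M) ^+ m + M * (3 * M) ^+ m + M * (3 * M) ^+ m by ring.
rewrite (le_trans (ler_normD _ _))// lerD ?(le_trans (ler_normD _ _)) ?lerD ?bd//.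
by case: (i) => [|j]//; rewrite normr0.
Qed.

(** Markov's inequality for x^(2j): with L = 3 M + 1 the mass outside [-L, L],
    multiplied by p_0^2 L^(2j), is at most the (2j)-th moment of p_0^2 dnu,
    hence at most (3 M)^(2j); and (3 M / L)^(2j) tends to 0. *)
Lemma support_jacobi_bound :
  nu (~` `[- (3 * M + 1), 3 * M + 1]%classic) = 0%E.
Proof.
have [sz lc _] := orth.
set L := 3 * M + 1.
have L0 : 0 < L by rewrite ltr_wpDl// mulr_ge0.
set S := ~` _.
have mS : measurable (S : set (measurableTypeR R)).
  by apply: measurableC; exact: measurable_itv.
have nuS : nu S \is a fin_num by exact: fin_num_measure.
pose c := lead_coef (p 0).
have c0 : 0 < c by exact: lc.
have pE x : (p 0).[x] = c.
  have /size1_polyC -> : (size (p 0) <= 1)%N by rewrite sz.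
  by rewrite hornerC /c lead_coefE sz.
pose s := fine (nu S).
have s0 : 0 <= s by rewrite fine_ge0.
suff : s <= 0.
  move=> s_le0; rewrite -(fineK nuS) -/s; congr (_ %:E).
  by apply/le_anti; rewrite s_le0 s0.
have key j : s * (c ^+ 2) <= ((3 * M / L) ^+ 2) ^+ j.
  rewrite -exprM expr_div_n ler_pdivlMr ?exprn_gt0//.
  apply: le_trans (le_trans (ler_norm _) (jacobi_power_bound (2 * j) 0 0)).
  rewrite /jacobi_power.
  have -> : s * c ^+ 2 * L ^+ (2 * j) =
     \int[nu]_x ((c ^+ 2 * L ^+ (2 * j)) * \1_S x).
    rewrite RintegralZl//; last first.
      exact: integrable_indic.
    by rewrite /Rintegral integral_indic// setIT -/s -mulrA mulrC.
  apply: le_Rintegral => //.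
  - apply: (@integrableZl _ _ _ nu setT measurableT
      (c ^+ 2 * L ^+ (2 * j)) (EFin \o \1_S)).
    exact: integrable_indic.
  - exact: (continuous_integrable nu0).
  move=> x _; rewrite !pE -mulrA (_ : _ * c * c = c ^+ 2 * x ^+ (2 * j)); last by ring.
  rewrite ler_pM2l ?exprn_gt0//.
  rewrite indicE; have [xS|_] := boolP (x \in S); last by rewrite mulr0 exprM exprn_ge0// sqr_ge0.
  rewrite mulr1 !exprM lerXn2r ?nnegrE ?sqr_ge0//.
  rewrite -[leRHS](real_normK (num_real x)) lerXn2r ?nnegrE// ?ltW//.
  by move: xS; rewrite inE /S/= in_itv/= -ler_norml => /negP; rewrite -ltNge.
have q1 : `|(3 * M / L) ^+ 2| < 1.
  rewrite normrX expr_lt1// ger0_norm ?divr_ge0 ?mulr_ge0//; last exact: ltW.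
  by rewrite ltr_pdivrMr// mul1r ltrDl.
have c20 : 0 < c ^+ 2 by rewrite exprn_gt0.
rewrite -(pmulr_lle0 _ c20) -(cvg_lim _ (cvg_expr q1))//.
apply: limr_ge; first by apply/cvg_ex; exists 0; exact: cvg_expr.
by apply: nearW => j; exact: key.
Qed.

End jacobi.

(** * Averages of arrays under a regular Norlund method *)

Section norlund.
Variables (R : realType) (s tau : nat -> {nonneg R}).
Local Notation w := (fun n k => (norlund_weight s tau n k)%:num).
Hypothesis reg : regular_method w.

Let tauS n : (tau n)%:num * \sum_(k < n.+1) (s k)%:num = 1.
Proof.
have [_ /(_ n) <- _] := reg; rewrite mulr_sumr [RHS](reindex_inj rev_ord_inj)/=.
apply: eq_bigr => k _; congr (_ * (s _)%:num).
by rewrite subSS subKn// -ltnS.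
Qed.

Lemma norlund_tau_gt0 n : 0 < (tau n)%:num.
Proof.
rewrite lt0r (ge0 (tau n)) andbT; apply: contra_eq_neq (tauS n) => ->.
by rewrite mul0r eq_sym oner_neq0.
Qed.

(** The weights of row n have sum 1, which determines tau n. *)
Lemma norlund_tauV n : (tau n)%:num^-1 = \sum_(k < n.+1) (s k)%:num.
Proof.
have t0 : (tau n)%:num != 0 by rewrite gt_eqF// norlund_tau_gt0.
by apply: (mulfI t0); rewrite tauS divff.
Qed.

Lemma norlund_tauV_nd n q : (tau n)%:num^-1 <= (tau (n + q))%:num^-1.
Proof.
elim: q => [|q IH]; first by rewrite addn0.
rewrite (le_trans IH)// addnS !norlund_tauV [leRHS]big_ord_recr/=.
by rewrite lerDl.
Qed.

Lemma norlund_tau_ni n q : (tau (n + q))%:num <= (tau n)%:num.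
Proof.
by rewrite -lef_pV2 ?posrE ?norlund_tau_gt0// norlund_tauV_nd.
Qed.

(** The averages of the mean Nevai class: X N k has upper index N = n - k and
    lower index k. *)
Definition average (X : nat -> nat -> R) n : R :=
  \sum_(k < n.+1) w n k * X (n - k)%N k.

Definition bounded_array (X : nat -> nat -> R) :=
  exists C, forall N k, `|X N k| <= C.

Definition null_array (X : nat -> nat -> R) :=
  average (fun N k => `|X N k|) n @[n --> \oo] --> 0.

Implicit Types X Y Z : nat -> nat -> R.

Lemma averageD X Y n :
  average (fun N k => X N k + Y N k) n = average X n + average Y n.
Proof.
by rewrite -big_split; apply: eq_bigr => k _; rewrite mulrDr.
Qed.

Lemma averageZ c X n : average (fun N k => c * X N k) n = c * average X n.
Proof. by rewrite mulr_sumr; apply: eq_bigr => k _; rewrite mulrCA. Qed.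

Lemma le_average X Y n : (forall N k, X N k <= Y N k) ->
  average X n <= average Y n.
Proof. by move=> XY; apply: ler_sum => k _; exact: ler_wpM2l. Qed.

Lemma average_ge0 X n : (forall N k, 0 <= X N k) -> 0 <= average X n.
Proof. by move=> X0; apply: sumr_ge0 => k _; exact: mulr_ge0. Qed.

Lemma ler_norm_average X n :
  `|average X n| <= average (fun N k => `|X N k|) n.
Proof.
rewrite (le_trans (ler_norm_sum _ _ _))//; apply: ler_sum => k _.
by rewrite normrM ger0_norm.
Qed.

Lemma null_array_le X Y : (forall N k, `|X N k| <= Y N k) ->
  average Y n @[n --> \oo] --> 0 -> null_array X.
Proof.
move=> XY Y0; apply: squeeze_cvgr (cvg_cst 0) Y0; apply: nearW => n.
by rewrite average_ge0//= le_average.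
Qed.

Lemma null_arrayD X Y : null_array X -> null_array Y ->
  null_array (fun N k => X N k + Y N k).
Proof.
move=> X0 Y0.
apply: (@null_array_le _ (fun N k => `|X N k| + `|Y N k|)).
  by move=> N k; exact: ler_normD.
under eq_fun do rewrite averageD.
have := cvgD X0 Y0; rewrite addr0; exact.
Qed.

Lemma null_arrayM X Y : bounded_array X -> null_array Y ->
  null_array (fun N k => X N k * Y N k).
Proof.
move=> [C XC] Y0; apply: (@null_array_le _ (fun N k => C * `|Y N k|)).
  by move=> N k; rewrite normrM ler_wpM2r.
under eq_fun do rewrite averageZ.
have := cvgM (cvg_cst C) Y0; rewrite mulr0; exact.
Qed.

(** Each column of weights tends to 0, so finitely many columns carry no mass
    in the limit. *)
Lemma null_array_early q X : bounded_array X ->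
  (forall N k, (q <= k)%N -> X N k = 0) -> null_array X.
Proof.
move=> [C XC] Xq; have [_ _ w0] := reg.
have cq : \sum_(k < q) C * w n k @[n --> \oo] --> 0.
  elim: q {Xq} => [|q IH].
    by under eq_fun do rewrite big_ord0; exact: cvg_cst.
  under eq_fun do rewrite big_ord_recr/=.
  have := cvgD IH (cvgM (cvg_cst C) (w0 q)); rewrite mulr0 addr0; exact.
have C0 : 0 <= C by exact: le_trans (XC 0 0).
apply: squeeze_cvgr (cvg_cst 0) cq; apply: nearW => n.
rewrite average_ge0//= /average.
rewrite -(big_mkord xpredT (fun k => w n k * `|X (n - k)%N k|)).
rewrite -(big_mkord xpredT (fun k => C * w n k)).
have [qn|nq] := leqP q n.+1.
  rewrite (big_cat_nat _ qn)//= [X in _ + X]big_nat_cond [X in _ + X]big1 ?addr0.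
    by apply: ler_sum => k _; rewrite mulrC ler_wpM2r.
  by move=> k /andP[/andP[qk _] _]; rewrite Xq// normr0 mulr0.
rewrite [leRHS](big_cat_nat _ (ltnW nq))//= -[leLHS]addr0 lerD//.
  by apply: ler_sum => k _; rewrite mulrC ler_wpM2r.
by apply: sumr_ge0 => k _; exact: mulr_ge0.
Qed.

Lemma bounded_arrayD X Y : bounded_array X -> bounded_array Y ->
  bounded_array (fun N k => X N k + Y N k).
Proof.
move=> [C XC] [D YD]; exists (C + D) => N k.
by rewrite (le_trans (ler_normD _ _))// lerD.
Qed.

Lemma bounded_arrayM X Y : bounded_array X -> bounded_array Y ->
  bounded_array (fun N k => X N k * Y N k).
Proof.
move=> [C XC] [D YD]; exists (C * D) => N k.
by rewrite normrM ler_pM.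
Qed.

Lemma bounded_arrayN X : bounded_array X ->
  bounded_array (fun N k => - X N k).
Proof. by move=> [C XC]; exists C => N k; rewrite normrN. Qed.

Lemma bounded_array_cst c : bounded_array (fun _ _ => c).
Proof. by exists `|c|. Qed.

Lemma null_array_eventually q X Y : bounded_array X -> bounded_array Y ->
  (forall N k, (q <= k)%N -> X N k = Y N k) -> null_array Y -> null_array X.
Proof.
move=> bX bY XY nY.
have -> : X = fun N k => (X N k - Y N k) + Y N k.
  by apply/funext => N; apply/funext => k; rewrite subrK.
apply: null_arrayD => //; apply: (@null_array_early q) => [|N k qk].
  by apply: bounded_arrayD => //; exact: bounded_arrayN.
by rewrite XY// subrr.
Qed.

(** This is where the Norlund structure enters.  Shifting k and n by q keeps
    n - k, so the row n + q of the shifted array is the row n of the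
    original one, with tau n replaced by the smaller tau (n + q). *)
Lemma null_array_shift q X : null_array X ->
  null_array (fun N k => if (q <= k)%N then X N (k - q)%N else 0).
Proof.
move=> nX; rewrite /null_array -(cvg_shiftn q).
apply: squeeze_cvgr (cvg_cst 0) nX; apply: nearW => n.
rewrite average_ge0//= /average.
rewrite -(big_mkord xpredT (fun k => w (n + q)%N k *
   `|if (q <= k)%N then X (n + q - k)%N (k - q)%N else 0|)).
rewrite (@big_cat_nat _ _ _ q)//=; last by lia.
rewrite big_nat_cond big1 ?add0r; last first.
  by move=> k /andP[/andP[_ kq] _]; rewrite leqNgt kq/= normr0 mulr0.
rewrite -[in X in X <= _](add0n q) big_addn -addSn addnK big_mkord.
apply: ler_sum => k _; rewrite leq_addl addnK subnDr.
rewrite ler_wpM2r//= ?subnDr// ler_wpM2r//.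
exact: norlund_tau_ni.
Qed.

Lemma null_arrayN X : null_array X -> null_array (fun N k => - X N k).
Proof.
by move=> nX; apply: null_array_le nX => N k; rewrite normrN.
Qed.

Lemma null_array_cvg X Y (l : R) : null_array (fun N k => Y N k - X N k) ->
  average X n @[n --> \oo] --> l -> average Y n @[n --> \oo] --> l.
Proof.
move=> nXY Xl.
have -> : average Y = fun n =>
    average (fun N k => Y N k - X N k) n + average X n.
  apply/funext => n; rewrite -averageD; congr average.
  by apply/funext => N; apply/funext => k; rewrite subrK.
rewrite -[l]add0r; apply: cvgD => //; apply/norm_cvg0P.
apply: squeeze_cvgr (cvg_cst 0) nXY; apply: nearW => n.
by rewrite normr_ge0 ler_norm_average.
Qed.

Section slowly_varying.
Variable c : nat -> nat -> R.
Hypotheses (bc : bounded_array c)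
  (slow : forall l, null_array (fun N k => c N (k + l)%N - c N k)).

(** A net translation by t - q: for k >= q set j = k - q, compare j + t with j
    and j with j + q = k, and transport both comparisons from j to k by
    null_array_shift. *)
Lemma null_array_translate t q :
  null_array (fun N k => c N (k + t - q)%N - c N k).
Proof.
have [C cC] := bc.
pose X N k := c N (k + t)%N - c N k.
pose Y N k := - (c N (k + q)%N - c N k).
apply: (@null_array_eventually q _ (fun N k =>
   (if (q <= k)%N then X N (k - q)%N else 0) +
   (if (q <= k)%N then Y N (k - q)%N else 0))).
- exists (C + C) => N k; rewrite (le_trans (ler_normB _ _))// lerD//.
- exists ((C + C) + (C + C)) => N k.
  have C0 : 0 <= C by exact: le_trans (cC 0 0).
  rewrite (le_trans (ler_normD _ _))// lerD//; case: ifP => _;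
    rewrite ?normr0 ?addr_ge0 ?normrN//;
    by rewrite (le_trans (ler_normB _ _))// lerD.
- move=> N k qk; rewrite qk /X /Y subnK// addnBAC// opprB addrC subrKA.
  by rewrite addrC.
- apply: null_arrayD; apply: null_array_shift; first exact: slow.
  exact/null_arrayN/slow.
Qed.

End slowly_varying.

Section stable.
Variables (a b : nat -> nat -> R).
Hypotheses (ba : bounded_array a) (bb : bounded_array b).
Hypotheses
  (slowa : forall l, null_array (fun N k => a N (k + l)%N - a N k))
  (slowb : forall l, null_array (fun N k => b N (k + l)%N - b N k)).
Hypothesis moments : forall la lb,
  cvgn (average (fun N k => a N k ^+ la * b N k ^+ lb)).

(** The test against all monomials in a and b, rather than the convergence of
    the average of X alone, makes the class stable under multiplication
    by a and b. *)
Definition stable_array X := bounded_array X /\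
  forall la lb, cvgn (average (fun N k => X N k * (a N k ^+ la * b N k ^+ lb))).

Lemma stable_array0 : stable_array (fun _ _ => 0).
Proof.
split=> [|la lb]; first exact: bounded_array_cst.
rewrite (_ : average _ = cst 0); first exact: is_cvg_cst.
by apply/funext => n; apply: big1 => k _; rewrite mul0r mulr0.
Qed.

Lemma stable_array1 : stable_array (fun _ _ => 1).
Proof.
split=> [|la lb]; first exact: bounded_array_cst.
have -> : (fun N k => 1 * (a N k ^+ la * b N k ^+ lb)) =
          (fun N k => a N k ^+ la * b N k ^+ lb).
  by apply/funext => N; apply/funext => k; rewrite mul1r.
exact: moments.
Qed.

Lemma stable_arrayD X Y : stable_array X -> stable_array Y ->
  stable_array (fun N k => X N k + Y N k).
Proof.
move=> [bX cX] [bY cY]; split; first exact: bounded_arrayD.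
move=> la lb.
have -> : average (fun N k => (X N k + Y N k) * (a N k ^+ la * b N k ^+ lb)) =
  fun n => average (fun N k => X N k * (a N k ^+ la * b N k ^+ lb)) n +
           average (fun N k => Y N k * (a N k ^+ la * b N k ^+ lb)) n.
  apply/funext => n; rewrite -averageD; congr average.
  by apply/funext => N; apply/funext => k; rewrite mulrDl.
exact: is_cvgD.
Qed.

Lemma stable_arrayMa X : stable_array X ->
  stable_array (fun N k => a N k * X N k).
Proof.
move=> [bX cX]; split; first exact: bounded_arrayM.
move=> la lb; have -> : (fun N k => a N k * X N k * (a N k ^+ la * b N k ^+ lb))
  = fun N k => X N k * (a N k ^+ la.+1 * b N k ^+ lb).
  by apply/funext => N; apply/funext => k; rewrite exprS; ring.
exact: cX.
Qed.

Lemma stable_arrayMb X : stable_array X ->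
  stable_array (fun N k => b N k * X N k).
Proof.
move=> [bX cX]; split; first exact: bounded_arrayM.
move=> la lb; have -> : (fun N k => b N k * X N k * (a N k ^+ la * b N k ^+ lb))
  = fun N k => X N k * (a N k ^+ la * b N k ^+ lb.+1).
  by apply/funext => N; apply/funext => k; rewrite [_ ^+ lb.+1]exprS; ring.
exact: cX.
Qed.

Lemma bounded_arrayX X n : bounded_array X ->
  bounded_array (fun N k => X N k ^+ n).
Proof.
move=> bX; elim: n => [|n IH].
  by under eq_fun do under eq_fun do rewrite expr0; exact: bounded_array_cst.
by under eq_fun do under eq_fun do rewrite exprS; exact: bounded_arrayM.
Qed.

Lemma stable_array_null X Y : stable_array X -> bounded_array Y ->
  null_array (fun N k => Y N k - X N k) -> stable_array Y.
Proof.
move=> [bX cX] bY nXY; split=> // la lb.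
have /cvg_ex[l Xl] := cX la lb; apply/cvg_ex; exists l.
apply: null_array_cvg Xl.
have -> : (fun N k => Y N k * (a N k ^+ la * b N k ^+ lb) -
                      X N k * (a N k ^+ la * b N k ^+ lb)) =
  fun N k => (a N k ^+ la * b N k ^+ lb) * (Y N k - X N k).
  by apply/funext => N; apply/funext => k; ring.
apply: null_arrayM => //.
by apply: bounded_arrayM; exact: bounded_arrayX.
Qed.

Variable J : nat -> nat -> nat -> nat -> R.
Hypotheses
  (J0 : forall N k i, J N 0 k i = (k == i)%:R)
  (JS : forall N m k i, J N m.+1 k i =
    b N i.+1 * J N m k i.+1 + a N i * J N m k i +
    b N i * (if i is j.+1 then J N m k j else 0))
  (bJ : forall m, exists C, forall N k i, `|J N m k i| <= C).

(** Induction on m along the three-term recursion, where the coefficients at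
    index k + t - q are replaced by those at index k.  Truncated
    subtraction encodes the offset t - q of either sign; it is exact once
    k >= q, and the smaller k are negligible. *)
Lemma stable_jacobi_power m t q :
  stable_array (fun N k => J N m k (k + t - q)%N).
Proof.
have bJs m' (f : nat -> nat) : bounded_array (fun N k => J N m' k (f k)).
  by have [C JC] := bJ m'; exists C.
elim: m t q => [|m IH] t q.
  have S : stable_array (fun _ _ => ((t == q)%:R : R)).
    by case: (t == q); [exact: stable_array1|exact: stable_array0].
  apply: stable_array_null S _ _; first exact: bJs.
  apply: (@null_array_early q) => [|N k qk].
    apply: bounded_arrayD; first exact: bJs.
    exact/bounded_arrayN/bounded_array_cst.
  rewrite J0; have -> : (k == k + t - q)%N = (t == q) by lia.
  by rewrite subrr.
have S : stable_array (fun N k => b N k * J N m k (k + t.+1 - q)%N +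
    a N k * J N m k (k + t - q)%N + b N k * J N m k (k + t - q.+1)%N).
  by apply: stable_arrayD; [apply: stable_arrayD|];
    [exact: stable_arrayMb|exact: stable_arrayMa|exact: stable_arrayMb].
apply: stable_array_null S _ _; first exact: bJs.
pose Z N k := J N m k (k + t.+1 - q)%N * (b N (k + t.+1 - q)%N - b N k) +
  J N m k (k + t - q)%N * (a N (k + t - q)%N - a N k) +
  J N m k (k + t - q.+1)%N * (b N (k + t - q)%N - b N k).
have bt c (f : nat -> nat) : bounded_array c -> bounded_array (fun N k => c N (f k)).
  by move=> [C cC]; exists C.
apply: (@null_array_eventually q.+1 _ Z).
- apply: bounded_arrayD; first exact: bJs.
  by apply: bounded_arrayN; apply: bounded_arrayD; [apply: bounded_arrayD|];
    apply: bounded_arrayM => //; exact: bJs.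
- by apply: bounded_arrayD; [apply: bounded_arrayD|];
    apply: bounded_arrayM; try exact: bJs; apply: bounded_arrayD;
    try exact: bounded_arrayN; exact: bt.
- move=> N k qk; rewrite JS /Z.
  have -> : (k + t.+1 - q = (k + t - q.+1).+2)%N by lia.
  have -> : (k + t - q = (k + t - q.+1).+1)%N by lia.
  by rewrite /=; ring.
- by apply: null_arrayD; [apply: null_arrayD|];
    apply: null_arrayM; try exact: bJs; exact: null_array_translate.
Qed.

End stable.
End norlund.

(** * Integration against a measure with a density *)

Section density_integral.
Import HBNNSimple.
Local Open Scope ereal_scope.
Context d (T : measurableType d) (R : realType).
Variables (mu : {measure set T -> \bar R}) (g : T -> R).
Hypotheses (mg : measurable_fun setT g) (g0 : forall x, (0 <= g x)%R).

(** True for indicators by definition of the density, hence for simple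
    functions by linearity, and in general by monotone convergence. *)
Lemma ge0_integral_mdensity (f : T -> \bar R) : (forall x, 0 <= f x) ->
  measurable_fun setT f ->
  \int[mdensity mu mg g0]_x f x = \int[mu]_x (f x * (g x)%:E).
Proof.
move=> f0 mf; set nu := mdensity mu mg g0.
have mT := @measurableT _ T.
pose h := nnsfun_approx mT mf.
have fE x : f x = limn (fun n => (h n x)%:E).
  by apply/esym/cvg_lim => //; exact: cvg_nnsfun_approx.
have -> : \int[nu]_x f x = limn (fun n => \int[nu]_x (h n x)%:E).
  under eq_integral do rewrite fE.
  apply: monotone_convergence => //.
  - by move=> n; exact/measurable_EFinP.
  - by move=> n x _; rewrite lee_fin.
  - by move=> x _ a b ab; rewrite lee_fin; exact/lefP/nd_nnsfun_approx.
have -> : \int[mu]_x (f x * (g x)%:E) =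
    limn (fun n => \int[mu]_x ((h n x)%:E * (g x)%:E)).
  have fg x : f x * (g x)%:E = limn (fun n => (h n x)%:E * (g x)%:E).
    apply/esym/cvg_lim => //; apply: cvgeZr => //.
    exact: cvg_nnsfun_approx.
  under eq_integral do rewrite fg.
  apply: monotone_convergence => //.
  - move=> n; apply: emeasurable_funM; exact/measurable_EFinP.
  - by move=> n x _; rewrite mule_ge0// lee_fin.
  - move=> x _ a b ab; rewrite lee_wpmul2r ?lee_fin//.
    exact/lefP/nd_nnsfun_approx.
congr (limn _); apply/funext => n.
have indich r : measurable_fun setT (fun x => (r * \1_(h n @^-1` [set r]) x)%:E).
  by apply/measurable_EFinP; exact: measurable_funM.
transitivity (\int[nu]_x (\sum_(y \in range (h n))
    (y * \1_(h n @^-1` [set y]) x)%:E)).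
  by apply: eq_integral => t _; rewrite fimfunE -fsumEFin.
rewrite ge0_integral_fsum//; last by move=> y x _; exact: nnfun_muleindic_ge0.
transitivity (\int[mu]_x (\sum_(y \in range (h n))
    ((y * \1_(h n @^-1` [set y]) x)%:E * (g x)%:E))); last first.
  apply: eq_integral => x _; rewrite -ge0_mule_fsuml.
    by rewrite fsumEFin// -(fimfunE _ x).
  by move=> y; exact: nnfun_muleindic_ge0.
rewrite ge0_integral_fsum//; last 2 first.
- move=> y; apply: emeasurable_funM => //; exact/measurable_EFinP.
- move=> y x _; apply: mule_ge0; last by rewrite lee_fin.
  exact: nnfun_muleindic_ge0.
apply: eq_fsbigr => r rhn.
have r0 : (0 <= r)%R by move: rhn; rewrite inE => -[t _ <-].
under eq_integral do rewrite EFinM.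
rewrite integralZl_indic_nnsfun// integral_indic// setIT.
under [RHS]eq_integral do rewrite EFinM -muleA.
rewrite ge0_integralZl//; last 2 first.
- apply: emeasurable_funM; exact/measurable_EFinP.
- by move=> t _; rewrite mule_ge0// lee_fin.
congr (_ * _).
transitivity (\int[mu]_(x in h n @^-1` [set r]) (g x)%:E) => //.
rewrite integral_mkcond; apply: eq_integral => x _.
by rewrite epatch_indic muleC.
Qed.

End density_integral.

(** * Antidiagonals, weighted means and mixtures *)

(** Both sides sum G over the pairs (N, l) with N + l <= n: the left one groups
    them by N = n - k, the right one by j = N + l. *)
Lemma sum_antidiagonals (R : realType) (G : nat -> nat -> R) n :
  \sum_(k < n.+1) \sum_(l < k.+1) G (n - k)%N l =
  \sum_(j < n.+1) \sum_(l < j.+1) G (j - l)%N l.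
Proof.
have rev m (H : nat -> nat -> R) :
    \sum_(k < m.+1) H (m - k)%N k = \sum_(k < m.+1) H k (m - k)%N.
  rewrite (reindex_inj rev_ord_inj)/=; apply: eq_bigr => k _.
  by rewrite subSS subKn// -ltnS.
rewrite (rev n (fun N k => \sum_(l < k.+1) G N l)).
elim: n => [|n IH]; first by rewrite !big_ord_recl !big_ord0.
rewrite [RHS]big_ord_recr -IH rev/= [LHS]big_ord_recr [X in _ = _ + X]big_ord_recr.
rewrite /= subnn big_ord1 addrA -big_split/=; congr (_ + _).
by apply: eq_bigr => k _; rewrite subSn ?big_ord_recr// -ltnS.
Qed.

(** The terms before the index N from which x is e / 2-close to l contribute a
    fixed amount B, while the total weight is at least c (n + 1). *)
Lemma cvg_weighted_mean (R : realType) (q x : nat -> R) (c l : R) : 0 < c ->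
  (forall j, c <= q j) -> x n @[n --> \oo] --> l ->
  (\sum_(j < n.+1) q j)^-1 * (\sum_(j < n.+1) q j * x j) @[n --> \oo] --> l.
Proof.
move=> c0 cq /cvgrPdist_le xl; apply/cvgrPdist_le => e e0.
have e20 : 0 < e / 2 by rewrite divr_gt0.
have [N _ xN] := xl _ e20.
have q0 j : 0 < q j by exact: lt_le_trans (cq j).
pose B := \sum_(j < N) q j * `|l - x j|.
have B0 : 0 <= B by apply: sumr_ge0 => j _; rewrite mulr_ge0// ltW.
near=> n.
set Q := \sum_(j < n.+1) q j.
have Qc : c * n.+1%:R <= Q.
  rewrite mulr_natr -[X in _ *+ X](card_ord n.+1) -sumr_const.
  by apply: ler_sum => j _.
have Q0 : 0 < Q by rewrite (lt_le_trans _ Qc)// mulr_gt0.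
have -> : l - Q^-1 * (\sum_(j < n.+1) q j * x j) =
    (\sum_(j < n.+1) q j * (l - x j)) / Q.
  under [in RHS]eq_bigr do rewrite mulrBr.
  by rewrite sumrB -mulr_suml -/Q; field; rewrite gt_eqF.
rewrite normrM normfV (gtr0_norm Q0) ler_pdivrMr//.
rewrite (le_trans (ler_norm_sum _ _ _))//.
have Nn : (N <= n.+1)%N by rewrite leqW//; near: n; exact: nbhs_infty_ge.
have BQ : B <= e / 2 * Q.
  rewrite (le_trans _ (ler_wpM2l (ltW e20) Qc))//.
  rewrite mulrA mulrC -ler_pdivrMr ?mulr_gt0//.
  have : B / (e / 2 * c) <= n%:R by near: n; exact: nbhs_infty_ger.
  by move=> /le_trans; apply; rewrite ler_nat.
have -> : \sum_(j < n.+1) `|q j * (l - x j)| =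
   B + \sum_(N <= j < n.+1) q j * `|l - x j|.
  rewrite /B -(big_mkord xpredT (fun j => q j * `|l - x j|)).
  rewrite -big_cat_nat//= big_mkord; apply: eq_bigr => j _.
  by rewrite normrM gtr0_norm.
rewrite [e]splitr mulrDl lerD//.
have : \sum_(N <= j < n.+1) q j * `|l - x j| <=
       \sum_(N <= j < n.+1) (e / 2) * q j.
  rewrite big_nat_cond [leRHS]big_nat_cond; apply: ler_sum => j.
  move=> /andP[/andP[Nj _] _]; rewrite mulrC ler_wpM2r ?(ltW (q0 j))//.
  exact: (xN j Nj).
move=> /le_trans; apply; rewrite -mulr_sumr ler_wpM2l ?(ltW e20)// /Q.
rewrite -(big_mkord xpredT q) [leRHS](big_cat_nat (leq0n N) Nn)//= lerDr.
by apply: sumr_ge0 => j _; exact: ltW.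
Unshelve. all: by end_near. Qed.

Section density_mixture.
Variable R : realType.
Local Notation RR := (measurableTypeR R).
Variables (n : nat) (nu : nat -> {finite_measure set RR -> \bar R}).
Variables (g : nat -> RR -> R) (mg : forall k, measurable_fun setT (g k)).
Hypothesis g0 : forall k x, 0 <= g k x.
Variables (wt : nat -> {nonneg R}) (L : R).
Hypotheses (nu0 : forall k, nu k (~` `[- L, L]%classic) = 0%E)
  (cg : forall k, continuous (g k : R -> R)).

Definition density_mixture : {measure set RR -> \bar R} :=
  msum (fun k => mscale (wt k) (mdensity (nu k) (mg k) (g0 k))) n.

Lemma ge0_integral_density_mixture (f : R -> R) : continuous f ->
  (forall x, 0 <= f x) ->
  (\int[density_mixture]_x (f x)%:E =
    (\sum_(k < n) (wt k)%:num * \int[nu k]_x (f x * g k x))%:E)%E.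
Proof.
move=> cf f0; have mf : measurable_fun setT (fun x : RR => (f x)%:E).
  by apply/measurable_EFinP; exact: continuous_measurable_RR.
rewrite /density_mixture ge0_integral_measure_sum//=; last first.
  by move=> x _; rewrite lee_fin.
rewrite -sumEFin; apply: eq_bigr => k _.
rewrite ge0_integral_mscale//=; last by move=> x _; rewrite lee_fin.
rewrite ge0_integral_mdensity//= EFinM; congr (_ * _)%E.
rewrite /Rintegral fineK; first by apply: eq_integral => x _; rewrite EFinM.
apply: integrable_fin_num => //; apply: (continuous_integrable (nu0 k)).
exact: continuousMf.
Qed.

End density_mixture.

(** The positive and negative parts of f are again continuous, and by
    hypothesis their integrals are finite and given by A, so that they can be
    subtracted. *)
Lemma integral_of_ge0 (R : realType) (L : R) (A : (R -> R) -> R)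
    (m : {measure set (measurableTypeR R) -> \bar R}) :
  positive_mean L A ->
  (forall f : R -> R, continuous f -> (forall x, (0 <= f x)%R) ->
    \int[m]_x (f x)%:E = (A f)%:E)%E ->
  forall f : R -> R, continuous f -> (\int[m]_x (f x)%:E = (A f)%:E)%E.
Proof.
move=> mA H f cf.
have cm (h : R -> R) : continuous h -> continuous (fun x => Num.max (h x) 0).
  move=> ch x; apply: (@continuous_max _ _ h (fun=> 0)); first exact: ch.
  exact: cvg_cst.
have cN : continuous (fun x => - f x) by move=> x; apply: cvgN; exact: cf.
have c1 := cm _ cf; have c2 := cm _ cN.
rewrite integralE.
have -> : (fun x => (f x)%:E)^\+%E = fun x => (Num.max (f x) 0)%:E.
  by apply/funext => x; rewrite funeposE EFin_max.
have -> : (fun x => (f x)%:E)^\-%E = fun x => (Num.max (- f x) 0)%:E.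
  by apply/funext => x; rewrite funenegE EFin_max.
rewrite !H//; try by move=> x; rewrite le_max lexx orbT.
rewrite -EFinB -(meanB mA)//; congr (A _)%:E; apply/funext => x.
by case: (leP (f x) 0) => fx; case: (leP (- f x) 0) => fx'; lra.
Qed.

(** * The averaged measures as positive functionals *)

Section averaged_functionals.
Variables (R : realType) (s tau : nat -> {nonneg R}).
Variable mu : nat -> {finite_measure set (measurableTypeR R) -> \bar R}.
Variables (p : nat -> nat -> {poly R}) (L : R).
Local Notation w := (fun n k => (norlund_weight s tau n k)%:num).
Hypotheses (reg : regular_method w)
  (mu0 : forall k, mu k (~` `[- L, L]%classic) = 0%E)
  (orth : forall k, orthonormal_polys (mu k) (p k)).
Implicit Types f : R -> R.

(** Integration against p_k^2 dmu^(N). *)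
Definition square_mean N k f : R := \int[mu N]_x (f x * (p N k).[x] ^+ 2).

Definition mu_bar_mean n f : R :=
  \sum_(k < n.+1) w n k * square_mean (n - k)%N k f.

Definition lambda_mean n f : R := (norlund_norm tau n)^-1 *
  \sum_(k < n.+1) w n k *
    \int[mu (n - k)%N]_x (f x * CDkernel (p (n - k)%N) k x x).

Lemma continuous_sqr_poly (q : {poly R}) : continuous (fun x => q.[x] ^+ 2).
Proof.
by under eq_fun do rewrite -horner_exp; exact: continuous_horner.
Qed.

Lemma continuous_CDkernel (q : nat -> {poly R}) k :
  continuous (fun x => CDkernel q k x x).
Proof.
rewrite /CDkernel; elim: k.+1 => [|m IH].
  by under eq_fun do rewrite big_ord0; exact: continuous_cst.
under eq_fun do rewrite big_ord_recr/= -expr2.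
by apply: continuousDf => //; exact: continuous_sqr_poly.
Qed.

Lemma positive_square_mean N k : positive_mean L (square_mean N k).
Proof.
apply: positive_mean_density => //; first exact: continuous_sqr_poly.
  by move=> x; exact: sqr_ge0.
by have [_ _ /(_ k k)] := orth N; rewrite eqxx.
Qed.

Lemma positive_mu_bar_mean n : positive_mean L (mu_bar_mean n).
Proof.
apply: (@positive_mean_convex _ L n.+1 (w n)
  (fun k => square_mean (n - k)%N k)) => //.
- by have [_ + _] := reg; exact.
- by move=> k _; exact: positive_square_mean.
Qed.

Lemma integral_CDkernel N k f : continuous f ->
  \int[mu N]_x (f x * CDkernel (p N) k x x) =
  \sum_(l < k.+1) square_mean N l f.
Proof.
move=> cf; rewrite /CDkernel.
have c2 l : continuous (fun x => f x * (p N l).[x] ^+ 2).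
  by apply: continuousMf => //; exact: continuous_sqr_poly.
elim: k.+1 => [|m IH].
  rewrite big_ord0; under eq_Rintegral do rewrite big_ord0 mulr0.
  by rewrite Rintegral_cst//= mul0r.
rewrite big_ord_recr -IH/= -(Rintegral_contD (mu0 N))//.
  by apply: eq_Rintegral => x _; rewrite big_ord_recr/= mulrDr -expr2.
apply: continuousMf => //; elim: m {IH} => [|m IH].
  by under eq_fun do rewrite big_ord0; exact: continuous_cst.
under eq_fun do rewrite big_ord_recr/= -expr2.
by apply: continuousDf => //; exact: continuous_sqr_poly.
Qed.

(** The factor tau n of the weights cancels the one of norlund_norm, and the
    double sum of s_N square_mean N l over N + l <= n that is left is
    regrouped by j = N + l. *)
Lemma lambda_meanE n f : continuous f -> lambda_mean n f =
  (\sum_(j < n.+1) (tau j)%:num^-1)^-1 *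
  \sum_(j < n.+1) (tau j)%:num^-1 * mu_bar_mean j f.
Proof.
move=> cf; have t0 j : (tau j)%:num != 0.
  by rewrite gt_eqF//; exact: norlund_tau_gt0 reg j.
pose G N l := (s N)%:num * square_mean N l f.
have -> : \sum_(j < n.+1) (tau j)%:num^-1 * mu_bar_mean j f =
    \sum_(j < n.+1) \sum_(l < j.+1) G (j - l)%N l.
  apply: eq_bigr => j _; rewrite mulr_sumr; apply: eq_bigr => l _.
  by rewrite /= mulrA mulKf.
have E : \sum_(k < n.+1) w n k *
      \int[mu (n - k)%N]_x (f x * CDkernel (p (n - k)%N) k x x) =
    (tau n)%:num * \sum_(k < n.+1) \sum_(l < k.+1) G (n - k)%N l.
  rewrite mulr_sumr; apply: eq_bigr => k _.
  rewrite integral_CDkernel// !mulr_sumr; apply: eq_bigr => l _.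
  by rewrite /= mulrA.
by rewrite -sum_antidiagonals /lambda_mean E invfM mulrACA mulVf ?mul1r.
Qed.

Lemma positive_lambda_mean n : positive_mean L (lambda_mean n).
Proof.
have t0 j : 0 < (tau j)%:num^-1 by rewrite invr_gt0; exact: norlund_tau_gt0 reg j.
set Q := (\sum_(j < n.+1) (tau j)%:num^-1)^-1.
have Q0 : 0 < \sum_(j < n.+1) (tau j)%:num^-1.
  by rewrite big_ord_recl ltr_pwDl// sumr_ge0// => j _; exact: ltW.
have mean : positive_mean L (fun f => \sum_(j < n.+1)
    (Q * (tau j)%:num^-1) * mu_bar_mean j f).
  apply: (@positive_mean_convex _ L n.+1 (fun j => Q * (tau j)%:num^-1)).
  - by move=> j _; rewrite mulr_ge0// ?ltW// invr_gt0.
  - by rewrite -mulr_sumr mulVf// gt_eqF.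
  - by move=> j _; exact: positive_mu_bar_mean.
apply: positive_mean_ext mean => f cf; rewrite lambda_meanE// mulr_sumr.
by apply: eq_bigr => j _; rewrite mulrA.
Qed.

Lemma cvg_lambda_mean f (l : R) : continuous f ->
  mu_bar_mean n f @[n --> \oo] --> l -> lambda_mean n f @[n --> \oo] --> l.
Proof.
move=> cf fl; under eq_fun do rewrite lambda_meanE//.
have t0 : 0 < (tau 0)%:num^-1.
  by rewrite invr_gt0; exact: norlund_tau_gt0 reg 0.
exact: (cvg_weighted_mean t0 (norlund_tauV_nd reg 0) fl).
Qed.

Lemma integral_mu_bar n f : continuous f ->
  (\int[mu_bar s tau mu p n]_x (f x)%:E = (mu_bar_mean n f)%:E)%E.
Proof.
move: f; apply: (integral_of_ge0 (positive_mu_bar_mean n)) => f cf f0.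
exact: (@ge0_integral_density_mixture R n.+1 (fun k => mu (n - k)%N)
  _ _ _ (norlund_weight s tau n) L (fun k => mu0 (n - k)%N)
  (fun k => @continuous_sqr_poly (p (n - k)%N k)) f cf f0).
Qed.

Lemma integral_lambda n f : continuous f ->
  (\int[lambda s tau mu p n]_x (f x)%:E = (lambda_mean n f)%:E)%E.
Proof.
move: f; apply: (integral_of_ge0 (positive_lambda_mean n)) => f cf f0.
rewrite ge0_integral_mscale//=; last 2 first.
- by apply/measurable_EFinP; exact: continuous_measurable_RR.
- by move=> x _; rewrite lee_fin.
rewrite EFinM; congr (_ * _)%E.
exact: (@ge0_integral_density_mixture R n.+1 (fun k => mu (n - k)%N)
  _ _ _ (norlund_weight s tau n) L (fun k => mu0 (n - k)%N)
  (fun k => @continuous_CDkernel (p (n - k)%N) k) f cf f0).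
Qed.

Section moments.
Variables (a b : nat -> nat -> R) (Sigma : nat -> nat -> R) (M : R).
Hypotheses (jac : forall k, jacobi_coefs (p k) (a k) (b k)) (M0 : 0 <= M)
  (aM : forall N k, `|a N k| <= M) (bM : forall N k, `|b N k| <= M).
Hypothesis slow : forall l, (0 < l)%N ->
  average s tau (fun N k => `|a N (k + l)%N - a N k|) n @[n --> \oo] --> 0 /\
  average s tau (fun N k => `|b N (k + l)%N - b N k|) n @[n --> \oo] --> 0.
Hypothesis mixed : forall la lb,
  average s tau (fun N k => a N k ^+ la * b N k ^+ lb) n @[n --> \oo]
    --> Sigma la lb.

(** The m-th moment of mu_bar n is the average of the diagonal entries of the
    m-th powers of the Jacobi matrices. *)
Lemma cvg_mu_bar_moments m : cvgn (fun n => mu_bar_mean n (fun x => x ^+ m)).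
Proof.
have slow0 (c : nat -> nat -> R) :
    (forall l, (0 < l)%N ->
      null_array s tau (fun N k => c N (k + l)%N - c N k)) ->
  forall l, null_array s tau (fun N k => c N (k + l)%N - c N k).
  move=> H [|l]; last exact: H.
  rewrite /null_array (_ : average _ _ _ = cst 0); first exact: cvg_cst.
  apply/funext => n; apply: big1 => k _.
  by rewrite addn0 subrr normr0 mulr0.
have slowa := slow0 a (fun l l0 => (slow l0).1).
have slowb := slow0 b (fun l l0 => (slow l0).2).
have cvg_mixed la lb :
    cvgn (average s tau (fun N k => a N k ^+ la * b N k ^+ lb)).
  by apply/cvg_ex; exists (Sigma la lb); exact: mixed.
have J0 N k i := jacobi_power0 (orth N) k i.
have JS N m' k i : jacobi_power (mu N) (p N) m'.+1 k i = _ :=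
  jacobi_powerS (mu0 N) (jac N) m' k i.
have bJ m' : exists C : R, forall N k i,
    `|jacobi_power (mu N) (p N) m' k i| <= C.
  exists ((3 * M) ^+ m') => N k i.
  exact: (jacobi_power_bound (mu0 N) (orth N) (jac N) M0 (aM N) (bM N)).
(* The diagonal entries are those with both shifts equal to 0. *)
have [_ /(_ 0 0) cJ] := stable_jacobi_power reg (ex_intro _ M aM)
  (ex_intro _ M bM) slowa slowb cvg_mixed J0 JS bJ m 0 0.
rewrite (_ : (fun n => _) = average s tau (fun N k =>
  jacobi_power (mu N) (p N) m k (k + 0 - 0)%N *
    (a N k ^+ 0 * b N k ^+ 0)))//.
apply/funext => n; apply: eq_bigr => k _.
rewrite addn0 subn0 !expr0 !mulr1; congr (_ * _).
by apply: eq_Rintegral => x _; rewrite -mulrA -expr2.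
Qed.

End moments.

End averaged_functionals.

Theorem theorem5 (R : realType) (s tau : nat -> {nonneg R})
    (Sigma : nat -> nat -> R)
    (mu : nat -> {finite_measure set (measurableTypeR R) -> \bar R})
    (p : nat -> nat -> {poly R}) (a b : nat -> nat -> R) :
  regular_method (fun n k => (norlund_weight s tau n k)%:num) ->
  (forall k, bounded_support (mu k)) ->
  (forall k, infinite_set (msupport (mu k))) ->
  (forall k, orthonormal_polys (mu k) (p k)) ->
  (forall k, jacobi_coefs (p k) (a k) (b k)) ->
  mean_nevai (fun n k => (norlund_weight s tau n k)%:num) Sigma a b ->
  exists mu_Sigma : probability (measurableTypeR R) R,
    [/\ weak_cvg (mu_bar s tau mu p) mu_Sigma,
        weak_cvg (lambda s tau mu p) mu_Sigma &
        forall f : R -> R, continuous f ->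
          mu_Sigma.-integrable setT (EFin \o f) /\
          (norlund_norm tau n)^-1 *
            (\sum_(k < n.+1) (norlund_weight s tau n k)%:num *
              \int[mu (n - k)%N]_x (f x * CDkernel (p (n - k)%N) k x x))
            @[n --> \oo] --> \int[mu_Sigma]_x f x].
Proof.
move=> reg supp _ orth jac [[[Ma aM] [Mb bM]] slow mom].
have aMa N k : `|a N k| <= Ma by apply: aM; exists (k, N).
have bMb N k : `|b N k| <= Mb by apply: bM; exists (k, N).
pose M := Num.max Ma Mb.
have aM' N k : `|a N k| <= M by rewrite le_max aMa.
have bM' N k : `|b N k| <= M by rewrite le_max bMb orbT.
have M0 : 0 <= M by exact: le_trans (aM' 0 0).
pose L := 3 * M + 1.
have L0 : 0 < L by rewrite ltr_wpDl// mulr_ge0.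
have mu0 k : mu k (~` `[- L, L]%classic) = 0%E.
  have [u [v uv]] := supp k.
  exact: (support_jacobi_bound uv (orth k) (jac k) M0 (aM' k) (bM' k)).
have [P [P0 AP]] := method_of_moments L0
  (positive_mu_bar_mean reg mu0 orth)
  (cvg_mu_bar_moments reg mu0 orth jac M0 aM' bM' slow mom).
have lamP f : continuous f ->
    lambda_mean s tau mu p n f @[n --> \oo] --> \int[P]_x f x.
  by move=> cf; apply: (cvg_lambda_mean reg mu0) => //; exact: AP.
have PE f : continuous f -> (\int[P]_x (f x)%:E = (\int[P]_x f x)%:E)%E.
  move=> cf; rewrite /Rintegral fineK//; apply: integrable_fin_num => //.
  exact: (continuous_integrable P0).
exists P; split.
- move=> f cf _; under eq_fun do rewrite (integral_mu_bar reg mu0 orth)//.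
  rewrite PE//; apply: cvg_EFin; first exact: nearW.
  exact: AP.
- move=> f cf _; under eq_fun do rewrite (integral_lambda reg mu0 orth)//.
  rewrite PE//; apply: cvg_EFin; first exact: nearW.
  exact: lamP.
- move=> f cf; split; first exact: (continuous_integrable P0).
  exact: lamP.
Qed.
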